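(* Let $M$ be a smooth $n$-dimensional manifold, let $\alpha,\beta\in\mathbb{R}$, and let $g(t)$, $t\in I$, be an $(\alpha,\beta)$-Ricci-Yamabe flow on $M$, i.e. a smooth family of Riemannian metrics with $$\partial_t g(t)=-2\alpha\, Ric(t)-\beta R(t)g(t).$$ Then: (1) The variation of the Christoffel symbols is $$\partial_t\Gamma^k_{ij}=\alpha g^{kl}\left(\nabla_l R_{ij}-\nabla_i R_{jl}-\nabla_j R_{il}\right)-\frac{\beta}{2}\left[(\nabla_i R)\delta^k_j+(\nabla_j R)\delta^k_i-(\nabla^k R)g_{ij}\right],$$ where all quantities on the right-hand side are taken with respect to $g(t)$. (2) The variation of the scalar curvature is $$\partial_t R(t)=[\alpha+(n-1)\beta]\,\Delta_{g(t)}R(t)+2\alpha\|Ric(t)\|^2_{g(t)}+\beta R^2(t).$$ For $n=2$ this becomes, with $K(t)$ the Gaussian curvature, $$\partial_t R(t)=(\alpha+\beta)\left[\Delta_{g(t)}R(t)+R^2(t)\right],\qquad \partial_t K(t)=(\alpha+\beta)\left[\Delta_{g(t)}K(t)+2K^2(t)\right].$$ (3) The variation of the volume form is $$\partial_t d\mu(t)=-\left(\alpha+\frac{n}{2}\beta\right)R(t)\,d\mu(t).$$ Consequently, if $2\alpha+n\beta=0$, then the volume is constant in $t$ and, provided $\alpha\neq 0$, the variation of the scalar curvature is $$\frac{1}{\alpha}\partial_t R(t)=\frac{2-n}{n}\Delta_{g(t)}R(t)+2\|Ric(t)\|^2_{g(t)}-\frac{2}{n}R^2(t),$$ which in particular is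 zero in dimension $n=2$. Moreover, for an $(\alpha,\beta)$-Ricci-Yamabe flow $g(t)$, $t\in(0,T]$, on a closed surface $M^2$ with $\alpha+\beta\geq 1$, one has on all of $M$, for every $t\in(0,T]$, $$K(t)\geq-\frac{1}{2(\alpha+\beta)t}.$$
   Context: $Ric(t)$, with components $R_{ij}$, is the Ricci tensor of $g(t)$ as a $(0,2)$-tensor; $R(t)$ is its scalar curvature; $\nabla$ is the Levi-Civita connection of $g(t)$, with Christoffel symbols $\Gamma^k_{ij}$ in local coordinates on $M$; $\nabla^k R=g^{kl}\nabla_l R$; $\delta^k_j$ is the Kronecker delta; repeated indices are summed. $\Delta_{g(t)}$ is the Laplacian of $g(t)$ on functions (the trace of the Hessian), $\|\cdot\|_{g(t)}$ is the tensor norm induced by $g(t)$, and $d\mu(t)$ is the Riemannian volume form of $g(t)$. ''The volume is constant'' means that the volume form $d\mu(t)$ does not depend on $t$. For $n=2$, $R=2K$ and $Ric=Kg$. $I\subseteq\mathbb{R}$ is an open interval. A closed surface is a compact two-dimensional manifold without boundary. *)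

(* Defs.v *)
(* MathComp-Analysis, over an arbitrary real number field R : realType. *)
From HB Require Import structures.
From mathcomp Require Import all_boot all_order all_algebra.
From mathcomp Require Import all_classical all_reals all_analysis.

Set Implicit Arguments.
Unset Strict Implicit.
Unset Printing Implicit Defensive.

Import Order.TTheory GRing.Theory Num.Theory.
Import numFieldNormedType.Exports.

Local Open Scope classical_set_scope.
Local Open Scope ring_scope.

Section Smoothness.
Context {R : realType} {V W : normedModType R}.

(* For finite-dimensional V this is the usual class C^oo on the open set U:
   every iterated directional derivative exists and is continuous on U. *)
Definition smooth_open (U : set V) (f : V -> W) : Prop :=
  forall (vs : seq V) (x : V), U x ->
    let h := foldr (fun v k => 'D_v k) f vs in
    {for x, continuous h} /\ forall v, derivable h x v.

(* The local-extension convention for smoothness on a set that need not be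
   open; it is what gives a meaning to smooth families over ]0, T]. *)
Definition smooth_on (A : set V) (f : V -> W) : Prop :=
  forall p, A p -> exists (U : set V) (F : V -> W),
    [/\ open U, U p, smooth_open U F & {in U `&` A, f =1 F}].

End Smoothness.

(* f has derivative l at t relative to I: two-sided at interior points of I,
   one-sided at endpoints of I that belong to I. *)
Definition has_derivative_within (R : realType) (W : normedModType R)
    (I : set R) (f : R -> W) (t : R) (l : W) : Prop :=
  (s - t)^-1 *: (f s - f t) @[s --> within I t^'] --> l.

(* chart_inv matters only on chart_cod, and chart_map only on chart_dom. *)
Record chart (R : realType) (n : nat) (M : topologicalType) := Chart {
  chart_dom : set M;
  chart_cod : set 'rV[R]_n;
  chart_map : M -> 'rV[R]_n;
  chart_inv : 'rV[R]_n -> M;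
  open_chart_dom : open chart_dom;
  open_chart_cod : open chart_cod;
  chart_map_cod : set_fun chart_dom chart_cod chart_map;
  chart_inv_dom : set_fun chart_cod chart_dom chart_inv;
  chart_mapK : {in chart_dom, cancel chart_map chart_inv};
  chart_invK : {in chart_cod, cancel chart_inv chart_map};
  chart_map_continuous : {within chart_dom, continuous chart_map};
  chart_inv_continuous : {within chart_cod, continuous chart_inv} }.

Definition transition (R : realType) (n : nat) (M : topologicalType)
    (a b : chart R n M) (x : 'rV[R]_n) : 'rV[R]_n :=
  chart_map b (chart_inv a x).

Definition overlap (R : realType) (n : nat) (M : topologicalType)
    (a b : chart R n M) : set 'rV[R]_n :=
  chart_cod a `&` chart_inv a @^-1` chart_dom b.

(* The atlas need not be maximal; taking it maximal gives all the local
   coordinates of the smooth structure. *)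
Record smooth_manifold (R : realType) (n : nat) := SmoothManifold {
  carrier :> topologicalType;
  manifold_hausdorff : hausdorff_space carrier;
  manifold_second_countable : @second_countable carrier;
  chart_index : Type;
  atlas : chart_index -> chart R n carrier;
  atlas_cover : forall p : carrier, exists c, chart_dom (atlas c) p;
  atlas_smooth : forall c d,
    smooth_on (overlap (atlas c) (atlas d)) (transition (atlas c) (atlas d)) }.

(* The components (T_ij) of a (0,2)-tensor field in every chart of the atlas,
   as functions of the coordinates. *)
Definition tensor2 (R : realType) (n : nat) (M : smooth_manifold R n) : Type :=
  chart_index M -> 'rV[R]_n -> 'M[R]_n.

(* The library's Jacobian acts on row vectors on the right, so its (i, a) entry
   is the i-th partial derivative of the a-th component, and the last clause is
   g_ij = (d_i y^a) (d_j y^b) g'_ab. *)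
Definition riemannian_metric (R : realType) (n : nat) (M : smooth_manifold R n)
    (h : tensor2 M) : Prop :=
  [/\ forall c, smooth_on (chart_cod (atlas c)) (h c),
      forall c x, chart_cod (atlas c) x -> (h c x)^T = h c x,
      forall c x, chart_cod (atlas c) x ->
        forall v : 'rV[R]_n, v != 0 -> 0 < (v *m h c x *m v^T) 0 0
    & forall c d x, overlap (atlas c) (atlas d) x ->
        let y := transition (atlas c) (atlas d) in
        h c x = 'J y x *m h d (y x) *m ('J y x)^T ].

Definition smooth_metric_family (R : realType) (n : nat)
    (M : smooth_manifold R n) (I : set R) (g : R -> tensor2 M) : Prop :=
  (forall t, I t -> riemannian_metric (g t)) /\
  (forall c, smooth_on (I `*` chart_cod (atlas c))
     (fun p : R * 'rV[R]_n => g p.1 c p.2)).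

Section LocalGeometry.
Context {R : realType} {n : nat}.
Implicit Types (G S : 'rV[R]_n -> 'M[R]_n) (u : 'rV[R]_n -> R)
  (i j k l : 'I_n) (x : 'rV[R]_n).

Definition pderiv i u x : R := 'D_(delta_mx 0 i) u x.

Definition ginv G x : 'M[R]_n := invmx (G x).

(* Gamma^k_ij *)
Definition christoffel G k i j x : R :=
  2^-1 * \sum_l ginv G x k l *
    (pderiv i (fun y => G y j l) x + pderiv j (fun y => G y i l) x
     - pderiv l (fun y => G y i j) x).

(* The d_l component of Rm(d_i, d_j) d_k, where
   Rm(X, Y) Z = nabla_X nabla_Y Z - nabla_Y nabla_X Z - nabla_[X, Y] Z. *)
Definition riemann G l i j k x : R :=
  pderiv i (christoffel G l j k) x - pderiv j (christoffel G l i k) x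
  + \sum_p (christoffel G l i p x * christoffel G p j k x
            - christoffel G l j p x * christoffel G p i k x).

Definition ricci G x : 'M[R]_n := \matrix_(j, k) \sum_i riemann G i i j k x.

Definition scalar_curv G x : R :=
  \sum_i \sum_j ginv G x i j * ricci G x i j.

(* (nabla_i S)_jk for a (0,2)-tensor S *)
Definition cov_deriv2 G S i j k x : R :=
  pderiv i (fun y => S y j k) x
  - \sum_p (christoffel G p i j x * S x p k + christoffel G p i k x * S x j p).

(* nabla^k u *)
Definition grad G u k x : R := \sum_l ginv G x k l * pderiv l u x.

Definition hessian G u i j x : R :=
  pderiv i (pderiv j u) x - \sum_k christoffel G k i j x * pderiv k u x.

Definition laplacian G u x : R :=
  \sum_i \sum_j ginv G x i j * hessian G u i j x.

Definition norm2_tensor2 G S x : R :=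
  \sum_i \sum_j \sum_k \sum_l
    ginv G x i k * ginv G x j l * S x i j * S x k l.

(* sqrt(det g) dx^1 /\ .. /\ dx^n, for the orientation given by the chart,
   evaluated on the n tangent vectors that are the rows of X. *)
Definition volume_form G x (X : 'M[R]_n) : R :=
  Num.sqrt (\det (G x)) * \det X.

End LocalGeometry.

(* The sectional curvature of the tangent plane,
   <Rm(d_1, d_2) d_2, d_1> / (|d_1|^2 |d_2|^2 - <d_1, d_2>^2). *)
Definition gauss_curv (R : realType) (G : 'rV[R]_2 -> 'M[R]_2)
    (x : 'rV[R]_2) : R :=
  (\sum_l G x l 0 * riemann G l 0 1 1 x)
    / (G x 0 0 * G x 1 1 - G x 0 1 ^+ 2).

Definition ricci_yamabe_flow (R : realType) (n : nat) (M : smooth_manifold R n)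
    (alpha beta : R) (I : set R) (g : R -> tensor2 M) : Prop :=
  smooth_metric_family I g /\
  forall t c x, I t -> chart_cod (atlas c) x ->
    has_derivative_within I (fun s => g s c x) t
      (- (2 * alpha) *: ricci (g t c) x
       - (beta * scalar_curv (g t c) x) *: g t c x).

Definition closed_manifold (R : realType) (n : nat) (M : smooth_manifold R n)
    : Prop := compact [set: M].

(* Main.v *)
Require Import Defs.
From HB Require Import structures.
From mathcomp Require Import all_boot all_order all_algebra.
From mathcomp Require Import all_classical all_reals all_analysis.
From mathcomp Require Import ring lra.

Set Implicit Arguments.
Unset Strict Implicit.
Unset Printing Implicit Defensive.

Import Order.TTheory GRing.Theory Num.Theory.
Import numFieldNormedType.Exports.

Local Open Scope classical_set_scope.
Local Open Scope ring_scope.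

(** The smooth functions on an open set form a commutative ring on which the
    directional derivatives act as commuting derivations.  In one chart, over
    a product of a time interval and a coordinate domain, everything in (1),
    (2) and (3) is therefore an identity in a commutative ring with n + 1
    commuting derivations, the first n spatial and the last one temporal, and
    is proved there once and for all, without any regularity side condition;
    evaluating at a point gives the statement about functions.

    In that ring, lowering an index of the Christoffel symbols gives
      d_t Gamma^k_ij = 1/2 g^kl (nabla_i h_jl + nabla_j h_il - nabla_l h_ij)
    for h = d_t g (T_chr), and (1) follows because h = -2 alpha Ric - beta R g
    and the metric is parallel.  For (2), d_t Ric is a difference of two
    divergences of d_t Gamma (T_ric, the Palatini identity).  Tracing it with
    the inverse metric needs only the two traces of d_t Gamma, and the
    contracted second Bianchi identity (contracted_bianchi) reduces both to
    multiples of the gradient of R; each divergence is then a multiple of the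
    Laplacian of R, and the quadratic terms come from the derivative of the
    inverse metric (flow_scal).  For (3), Jacobi's formula for the derivative
    of a determinant (der_det) reduces the volume to the trace of h.  In
    dimension two the symmetries of the curvature tensor leave one component,
    so Ric = K g (surface_ric), which specializes all the formulas.

    The lower bound for K is the minimum principle.  Put a = alpha + beta.  On
    a surface the flow reads d_t g = -2 a K g; since g transforms as a tensor
    with a factor that does not depend on t, and a is not 0, K is the same
    function in all charts (gauss_chart_indep), without transforming the
    curvature tensor.  For e > 0 the continuous function
    (s - e) K(s, p) has a minimum on the compact set [e, t] x M.  At a
    minimum with s > e the Laplacian of K is nonnegative, so that the time
    derivative is at least K (1 + 2 a (s - e) K), whereas the left difference
    quotients are nonpositive; hence 2 a (s - e) K >= -1 there
    (weighted_gauss_bound), and e tends to 0.  At the final time T only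
    one-sided information is available: for s < T the bound says that
    g_00(s) / s is nonincreasing, and comparing with the left derivative of
    g_00 at T gives the bound at T (left_derivative_bound). *)

(** * Derivations of a commutative ring *)

Section Derivation.
Context {A : comPzRingType}.

Record derivation (d : A -> A) : Prop := Derivation {
  derD : forall a b, d (a + b) = d a + d b;
  derM : forall a b, d (a * b) = d a * b + a * d b }.

Variables (d : A -> A) (dP : derivation d).

Lemma der0 : d 0 = 0.
Proof. by apply: (addrI (d 0)); rewrite -(derD dP) !addr0. Qed.

Lemma derN a : d (- a) = - d a.
Proof. by apply: (addrI (d a)); rewrite -(derD dP) !subrr der0. Qed.

Lemma derB a b : d (a - b) = d a - d b.
Proof. by rewrite (derD dP) derN. Qed.

Lemma der1 : d 1 = 0.
Proof.
by apply: (addrI (d 1)); rewrite addr0 -[RHS](congr1 d (mulr1 1)) (derM dP) mulr1 mul1r.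
Qed.

Lemma der_nat m : d m%:R = 0.
Proof. by elim: m => [|m IH]; rewrite ?der0 // -natr1 (derD dP) IH der1 addr0. Qed.

Lemma der_sum (I : Type) (r : seq I) (P : pred I) (F : I -> A) :
  d (\sum_(i <- r | P i) F i) = \sum_(i <- r | P i) d (F i).
Proof. by apply: (big_morph d (derD dP) der0). Qed.

Lemma der_half h : h + h = 1 -> d h = 0.
Proof.
move=> hh; have: d h + d h = 0 by rewrite -(derD dP) hh der1.
by move=> e; rewrite -[d h]mul1r -hh mulrDl -mulrDr e mulr0.
Qed.

Lemma derMc c a : d c = 0 -> d (c * a) = c * d a.
Proof. by move=> e; rewrite (derM dP) e mul0r add0r. Qed.

(** Jacobi's formula.  By the Leibniz rule the derivative of the determinant
    is the sum of the determinants in which one row is differentiated; each is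
    expanded along that row. *)
Lemma der_det m (M : 'M[A]_m) :
  d (\det M) = \sum_i \sum_j d (M i j) * cofactor M i j.
Proof.
have der_prod (I : finType) (F : I -> A) :
    d (\prod_i F i) = \sum_k \prod_i (if i == k then d (F i) else F i).
  pose S (s : seq I) := \sum_(k <- s) \prod_(i <- s) (if i == k then d (F i) else F i).
  have H s : uniq s -> d (\prod_(i <- s) F i) = S s.
    elim: s => [|a s IH] /=; first by rewrite /S !big_nil der1.
    case/andP=> nas us; rewrite /S big_cons (derM dP) IH // [RHS]big_cons.
    rewrite big_cons eqxx; congr (_ + _).
      congr (_ * _); rewrite !big_seq; apply: eq_bigr => i si.
      by case: eqP => // e; rewrite e (negPf nas) in si.
    rewrite mulr_sumr !big_seq; apply: eq_bigr => k sk.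
    rewrite big_cons; case: eqP => // e; by rewrite -e (negbTE nas) in sk.
  exact: (H _ (index_enum_uniq I)).
pose N k : 'M[A]_m := \matrix_(i, j) if i == k then d (M i j) else M i j.
transitivity (\sum_k \det (N k)).
  rewrite {1}/determinant der_sum exchange_big /=; apply: eq_bigr => s _.
  rewrite derMc; last first.
    by rewrite -signr_odd; case: odd; rewrite ?expr0 ?expr1 ?derN der1 ?oppr0.
  rewrite der_prod mulr_sumr; apply: eq_bigr => k _; congr (_ * _).
  by apply: eq_bigr => i _; rewrite mxE.
apply: eq_bigr => k _; rewrite (expand_det_row _ k); apply: eq_bigr => j _.
rewrite mxE eqxx; congr (_ * _); rewrite /cofactor; congr (_ * \det _).
by apply/matrixP => a b; rewrite !mxE eq_sym (negbTE (neq_lift _ _)).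
Qed.

End Derivation.

(** * Curvature over a ring with commuting derivations *)

Lemma sum_delta (A : comPzRingType) (I : finType) (i : I) (a : I -> A) :
  \sum_k (i == k)%:R * a k = a i.
Proof.
rewrite (bigD1 i) //= eqxx mul1r big1 ?addr0 // => k ki.
by rewrite eq_sym (negPf ki) mul0r.
Qed.

(** Here [D i] is the i-th coordinate derivative, [half] is 1/2, and [g], [q]
    are the components of the metric and of its inverse.  The formulas are
    those of the local geometry of a chart, read in a ring [A]. *)
Section Curvature.
Context {A : comPzRingType} {n : nat}.
Variables (D : 'I_n -> A -> A) (half : A) (g q : 'I_n -> 'I_n -> A).
Hypothesis D_der : forall i, derivation (D i).
Hypothesis D_comm : forall i j a, D i (D j a) = D j (D i a).
Hypothesis half2 : half + half = 1.
Hypothesis gC : forall i j, g i j = g j i.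
Hypothesis qC : forall i j, q i j = q j i.
Hypothesis gq : forall i j, \sum_k g i k * q k j = (i == j)%:R.

(** The Christoffel symbols of the first kind, i.e. with the upper index
    lowered by the metric (chr_lowE). *)
Definition chr_low m i j := half * (D i (g j m) + D j (g i m) - D m (g i j)).
Definition chr k i j :=
  half * \sum_l q k l * (D i (g j l) + D j (g i l) - D l (g i j)).
Definition riem l i j k :=
  D i (chr l j k) - D j (chr l i k)
  + \sum_p (chr l i p * chr p j k - chr l j p * chr p i k).
Definition ric j k := \sum_i riem i i j k.
Definition scal := \sum_i \sum_j q i j * ric i j.
Definition covd (S : 'I_n -> 'I_n -> A) i j k :=
  D i (S j k) - \sum_p (chr p i j * S p k + chr p i k * S j p).
Definition gradient u k := \sum_l q k l * D l u.
Definition lapl u :=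
  \sum_i \sum_j q i j * (D i (D j u) - \sum_k chr k i j * D k u).

Lemma qg i j : \sum_k q i k * g k j = (i == j)%:R.
Proof.
by rewrite eq_sym -gq; apply: eq_bigr => k _; rewrite qC gC mulrC.
Qed.

Lemma contr_gq i (a : 'I_n -> A) : \sum_k g i k * (\sum_l q k l * a l) = a i.
Proof.
rewrite -[RHS](sum_delta i).
under eq_bigr do rewrite mulr_sumr.
rewrite exchange_big; apply: eq_bigr => l _; rewrite -gq mulr_suml.
by apply: eq_bigr => k _; rewrite mulrA.
Qed.

Lemma contr_qg i (a : 'I_n -> A) : \sum_k q i k * (\sum_l g k l * a l) = a i.
Proof.
rewrite -[RHS](sum_delta i).
under eq_bigr do rewrite mulr_sumr.
rewrite exchange_big; apply: eq_bigr => l _; rewrite -qg mulr_suml.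
by apply: eq_bigr => k _; rewrite mulrA.
Qed.

(** Identities that carry the inverse metric are proved after lowering an
    index, where only the metric gets differentiated. *)
Lemma lowering_inj (a b : 'I_n -> A) :
  (forall m, \sum_k g m k * a k = \sum_k g m k * b k) -> a =1 b.
Proof.
move=> e i; rewrite -(contr_qg i a) -(contr_qg i b).
by apply: eq_bigr => k _; rewrite e.
Qed.

Lemma halfE a : half * a + half * a = a.
Proof. by rewrite -mulrDl half2 mul1r. Qed.

Lemma double_inj (a b : A) : a + a = b + b -> a = b.
Proof.
move=> e; rewrite -(halfE a) -(halfE b) -!mulrDr; congr (_ * _).
exact: e.
Qed.

Lemma chrC k i j : chr k i j = chr k j i.
Proof.
congr (_ * _); apply: eq_bigr => l _.
by rewrite (gC i j) [in LHS](addrC (D i _)).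
Qed.

Lemma chrE k i j : chr k i j = \sum_l q k l * chr_low l i j.
Proof. by rewrite /chr mulr_sumr; apply: eq_bigr => l _; rewrite mulrCA. Qed.

Lemma chr_lowE m i j : chr_low m i j = \sum_k g m k * chr k i j.
Proof. by under eq_bigr do rewrite chrE; rewrite contr_gq. Qed.

Lemma D_metric_low i j k : D i (g j k) = chr_low k i j + chr_low j i k.
Proof.
rewrite /chr_low (gC i k) (gC i j) (gC k j) -[LHS]halfE; ring.
Qed.

(** The metric is parallel. *)
Lemma D_metric i j k :
  D i (g j k) = \sum_p (chr p i j * g p k + chr p i k * g j p).
Proof.
rewrite D_metric_low !chr_lowE -big_split /=; apply: eq_bigr => p _.
by rewrite (gC k p); ring.
Qed.

(** The inverse metric is parallel: differentiate g q = 1. *)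
Lemma D_cometric i j k :
  D i (q j k) = - \sum_p (chr j i p * q p k + chr k i p * q j p).
Proof.
move: j; apply: lowering_inj => m.
have /eqP : D i (\sum_a g m a * q a k) = 0 by rewrite gq der_nat.
rewrite (der_sum (D_der i)); under eq_bigr do rewrite (derM (D_der i)).
rewrite big_split /= addrC addr_eq0 => /eqP ->.
under [in RHS]eq_bigr do rewrite mulrN.
rewrite sumrN; congr (- _).
have -> : \sum_a D i (g m a) * q a k
    = chr k i m + \sum_a \sum_p chr p i a * g m p * q a k.
  rewrite -(sum_delta k (fun p => chr p i m)).
  under [X in _ = X + _]eq_bigr => p _ do rewrite eq_sym -gq mulr_suml.
  rewrite [X in _ = X + _]exchange_big -big_split /=; apply: eq_bigr => a _.
  rewrite D_metric mulr_suml -big_split /=; apply: eq_bigr => p _; ring.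
under [RHS]eq_bigr do rewrite big_split mulrDr /=.
rewrite big_split /= addrC; congr (_ + _).
  under [RHS]eq_bigr do under eq_bigr do rewrite mulrC.
  by rewrite contr_gq.
rewrite exchange_big /=; apply: eq_bigr => p _; rewrite mulr_sumr.
by apply: eq_bigr => a _; ring.
Qed.

(** Traces commute with covariant derivatives, for an arbitrary family [X] of
    components; it is also applied to slices of tensors of higher rank, the
    other indices being frozen. *)
Lemma trace_covd m (X : 'I_n -> 'I_n -> A) :
  D m (\sum_j \sum_k q j k * X j k) = \sum_j \sum_k q j k * covd X m j k.
Proof.
have -> : \sum_j \sum_k q j k * covd X m j k =
    \sum_j \sum_k q j k * D m (X j k)
    - (\sum_j \sum_k \sum_p q j k * (chr p m j * X p k)
       + \sum_j \sum_k \sum_p q j k * (chr p m k * X j p)).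
  rewrite -!big_split -sumrB /=; apply: eq_bigr => j _.
  rewrite -!big_split -sumrB /=; apply: eq_bigr => k _.
  by rewrite /covd mulrBr mulr_sumr -big_split /=; under eq_bigr do rewrite mulrDr.
have -> : \sum_j \sum_k \sum_p q j k * (chr p m j * X p k)
   = \sum_j \sum_k \sum_p chr j m p * q p k * X j k.
  rewrite exchange_big [RHS]exchange_big /=; apply: eq_bigr => k _.
  rewrite exchange_big /=; apply: eq_bigr => j _; apply: eq_bigr => p _; ring.
have -> : \sum_j \sum_k \sum_p q j k * (chr p m k * X j p)
   = \sum_j \sum_k \sum_p chr k m p * q j p * X j k.
  apply: eq_bigr => j _; rewrite exchange_big /=.
  by apply: eq_bigr => k _; apply: eq_bigr => p _; ring.
rewrite (der_sum (D_der m)) -!big_split -sumrB /=; apply: eq_bigr => j _.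
rewrite (der_sum (D_der m)) -!big_split -sumrB /=; apply: eq_bigr => k _.
rewrite (derM (D_der m)) D_cometric mulNr mulr_suml -big_split /= addrC.
by congr (_ - _); apply: eq_bigr => p _; rewrite mulrDl.
Qed.

Lemma riem_anti12 l i j k : riem l j i k = - riem l i j k.
Proof.
rewrite /riem opprD opprB; congr (_ + _); rewrite -sumrN.
by apply: eq_bigr => p _; rewrite opprB.
Qed.

Lemma low_riem s i j k :
  \sum_l g s l * riem l i j k =
  D i (chr_low s j k) - D j (chr_low s i k)
  - \sum_l (chr_low l i s * chr l j k - chr_low l j s * chr l i k).
Proof.
have Dlow a b c : D a (chr_low s b c) = \sum_l g s l * D a (chr l b c)
    + \sum_l (chr_low l a s + chr_low s a l) * chr l b c.
  rewrite chr_lowE (der_sum (D_der a)) -big_split /=; apply: eq_bigr => l _.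
  by rewrite (derM (D_der a)) D_metric_low addrC.
have E a b : \sum_l chr_low s a l * chr l b k
    = \sum_l g s l * \sum_p chr l a p * chr p b k.
  under eq_bigr do rewrite chr_lowE mulr_suml.
  rewrite exchange_big /=; apply: eq_bigr => l _; rewrite mulr_sumr.
  by apply: eq_bigr => p _; ring.
have Dsplit a b : \sum_l (chr_low l a s + chr_low s a l) * chr l b k
  = \sum_l chr_low l a s * chr l b k + \sum_l g s l * \sum_p chr l a p * chr p b k.
  by rewrite -E -big_split /=; apply: eq_bigr => l _; rewrite mulrDl.
rewrite !Dlow !Dsplit sumrB.
have -> : \sum_l g s l * riem l i j k =
  \sum_l g s l * D i (chr l j k) - \sum_l g s l * D j (chr l i k)
  + (\sum_l g s l * (\sum_p chr l i p * chr p j k)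
     - \sum_l g s l * (\sum_p chr l j p * chr p i k)).
  rewrite -!sumrB -big_split /=; apply: eq_bigr => l _.
  by rewrite /riem sumrB; ring.
by ring.
Qed.

(** By low_riem, what is left of the symmetrization in s and k is the
    commutator of the derivatives i and j applied to g_sk, because the first
    derivatives of the metric are sums of two lowered Christoffel symbols. *)
Lemma riem_anti34 s i j k :
  \sum_l g s l * riem l i j k = - \sum_l g k l * riem l i j s.
Proof.
apply/eqP; rewrite -addr_eq0 !low_riem; apply/eqP.
have E a b c d : \sum_l chr_low l a b * chr l c d = \sum_l chr_low l c d * chr l a b.
  under eq_bigr do rewrite chr_lowE mulr_suml.
  under [RHS]eq_bigr do rewrite chr_lowE mulr_suml.
  rewrite exchange_big; apply: eq_bigr => l _; apply: eq_bigr => m _ /=.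
  by rewrite (gC m); ring.
have -> : D i (chr_low s j k) = D i (D j (g s k)) - D i (chr_low k j s).
  by rewrite D_metric_low (derD (D_der i)); ring.
have -> : D j (chr_low s i k) = D i (D j (g s k)) - D j (chr_low k i s).
  by rewrite D_comm D_metric_low (derD (D_der j)); ring.
by rewrite !sumrB (E i k) (E j k); ring.
Qed.

(** In terms of the connection matrices (Gamma_i)^l_k = Gamma^l_ik and the
    curvature matrices F_ij, this is the entry (l, k) of
    d_m F_ij + [Gamma_m, F_ij].  Its cyclic sum vanishes by the Jacobi identity. *)
Definition dcurv m i j l k :=
  D m (riem l i j k)
  + \sum_p (chr l m p * riem p i j k - riem l i j p * chr p m k).

Lemma dcurv_cyclic m i j l k :
  dcurv m i j l k + dcurv i j m l k + dcurv j m i l k = 0.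
Proof.
pose cube a b c := \sum_p \sum_r chr l a p * chr p b r * chr r c k.
pose lin a b c := \sum_p chr l a p * D b (chr p c k).
pose lin' a b c := \sum_p D b (chr l a p) * chr p c k.
have E a b c : dcurv a b c l k =
    D a (D b (chr l c k)) - D a (D c (chr l b k))
    + (lin' b a c + lin b a c - (lin' c a b + lin c a b))
    + (lin a b c - lin a c b + (cube a b c - cube a c b))
    - (lin' c b a - lin' b c a + (cube b c a - cube c b a)).
  have E1 : \sum_p chr l a p * riem p b c k
      = lin a b c - lin a c b + (cube a b c - cube a c b).
    rewrite -!sumrB -big_split /=; apply: eq_bigr => p _.
    rewrite -sumrB mulrDr mulrBr mulr_sumr; congr (_ + _).
    by apply: eq_bigr => r _; ring.
  have E2 : \sum_p riem l b c p * chr p a k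
      = lin' c b a - lin' b c a + (cube b c a - cube c b a).
    have cubeE x y z : cube x y z
        = \sum_p \sum_r chr l x r * chr r y p * chr p z k by exact: exchange_big.
    rewrite !cubeE -!sumrB -big_split /=; apply: eq_bigr => p _.
    rewrite -sumrB mulrDl mulrBl mulr_suml; congr (_ + _).
    by apply: eq_bigr => r _; ring.
  rewrite /dcurv sumrB E1 E2 addrA; congr (_ + _ - _).
  rewrite /riem (derD (D_der a)) (derB (D_der a)) (der_sum (D_der a)); congr (_ + _).
  rewrite -!big_split -sumrB /=; apply: eq_bigr => p _.
  by rewrite (derB (D_der a)) !(derM (D_der a)).
by rewrite !E (D_comm i m) (D_comm j i) (D_comm j m); ring.
Qed.

(** The component nabla_m R_ijk^l. *)
Definition nriem m l i j k :=
  dcurv m i j l k - \sum_p (chr p m i * riem l p j k + chr p m j * riem l i p k).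

Lemma nriem_anti m l i j k : nriem m l j i k = - nriem m l i j k.
Proof.
have dA : dcurv m j i l k = - dcurv m i j l k.
  rewrite /dcurv riem_anti12 (derN (D_der m)) opprD -sumrN; congr (_ + _).
  by apply: eq_bigr => p _; rewrite !(riem_anti12 _ i j); ring.
rewrite /nriem dA opprB addrC; congr (_ - _).
rewrite -sumrN; apply: eq_bigr => p _.
by rewrite (riem_anti12 _ p j) (riem_anti12 _ i p); ring.
Qed.

(** The terms that correct the indices i and j in [nriem] cancel in the cyclic
    sum because the connection is torsion free. *)
Lemma second_bianchi m l i j k :
  nriem m l i j k + nriem i l j m k + nriem j l m i k = 0.
Proof.
pose c a b d := \sum_p chr p a b * riem l p d k.
have E a b d : nriem a l b d k = dcurv a b d l k - (c a b d - c a d b).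
  rewrite /nriem; congr (_ - _); rewrite -sumrB; apply: eq_bigr => p _.
  by rewrite (riem_anti12 _ p b); ring.
have cC a b d : c a b d = c b a d.
  by apply: eq_bigr => p _; rewrite chrC.
by rewrite !E (cC i m) (cC j m) (cC j i) -[RHS](dcurv_cyclic m i j l k); ring.
Qed.

Lemma first_bianchi l i j k : riem l i j k + riem l j k i + riem l k i j = 0.
Proof.
rewrite /riem !(chrC l j i) !(chrC l k i) !(chrC l k j) -!addrA.
pose c a b d := \sum_p chr l a p * chr p b d.
have E a b d : \sum_p (chr l a p * chr p b d - chr l b p * chr p a d) = c a b d - c b a d.
  by rewrite sumrB.
have cC a b d : c a b d = c a d b.
  by apply: eq_bigr => p _; rewrite (chrC p).
by rewrite !E (cC i k) (cC j i) (cC k j); ring.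
Qed.

(** The trace of an endomorphism that is antisymmetric for the metric. *)
Lemma trace_riem i j : \sum_k riem k i j k = 0.
Proof.
apply: double_inj; rewrite addr0.
have E : \sum_k riem k i j k
    = \sum_k \sum_s q k s * \sum_l g s l * riem l i j k.
  by apply: eq_bigr => k _; rewrite (contr_qg k (fun l => riem l i j k)).
rewrite {1}E exchange_big /= E -big_split big1 //= => s _.
rewrite -big_split big1 //= => k _.
by rewrite (riem_anti34 s) (qC k s); ring.
Qed.

(** Trace the first Bianchi identity: the term that spoils the symmetry is the
    trace of the curvature endomorphism, which vanishes. *)
Lemma ricC j k : ric j k = ric k j.
Proof.
apply/eqP; rewrite -subr_eq0 /ric -sumrB -[X in _ == X](trace_riem k j); apply/eqP.
apply: eq_bigr => i _.
have /eqP := first_bianchi i i j k.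
rewrite (riem_anti12 i i k j) (riem_anti12 i k j i) addrAC subr_eq0.
by move/eqP.
Qed.

Lemma trace_nriem m j k : \sum_i nriem m i i j k = covd ric m j k.
Proof.
pose s1 := \sum_i \sum_p chr i m p * riem p i j k.
pose s2 := \sum_i \sum_p riem i i j p * chr p m k.
pose s3 := \sum_i \sum_p chr p m i * riem i p j k.
pose s4 := \sum_i \sum_p chr p m j * riem i i p k.
have -> : \sum_i nriem m i i j k
    = \sum_i D m (riem i i j k) + (s1 - s2 - (s3 + s4)).
  rewrite -!big_split -!sumrB -big_split /=; apply: eq_bigr => i _.
  by rewrite -big_split /nriem /dcurv sumrB /= -addrA.
have -> : s1 = s3 by exact: exchange_big.
have -> : s3 - s2 - (s3 + s4) = - (s4 + s2) by ring.
rewrite /covd (der_sum (D_der m)) big_split /=; congr (_ - (_ + _)).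
  by rewrite /s4 exchange_big; apply: eq_bigr => p _; rewrite mulr_sumr.
rewrite /s2 exchange_big; apply: eq_bigr => p _; rewrite mulr_sumr.
by apply: eq_bigr => i _; rewrite mulrC.
Qed.

(** Covariant derivatives commute with raising an index. *)
Lemma covd_raise i l m (Y : 'I_n -> 'I_n -> A) :
  D i (\sum_s q l s * Y m s)
  + \sum_p (chr l i p * (\sum_s q p s * Y m s) - chr p i m * \sum_s q l s * Y p s)
  = \sum_s q l s * covd Y i m s.
Proof.
rewrite (der_sum (D_der i)) sumrB.
have -> : \sum_p chr l i p * (\sum_s q p s * Y m s)
    = \sum_s (\sum_p chr l i p * q p s) * Y m s.
  under eq_bigr do rewrite mulr_sumr.
  rewrite exchange_big /=; apply: eq_bigr => s _; rewrite mulr_suml.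
  by apply: eq_bigr => p _; ring.
have -> : \sum_p chr p i m * (\sum_s q l s * Y p s)
    = \sum_s q l s * \sum_p chr p i m * Y p s.
  under eq_bigr do rewrite mulr_sumr.
  rewrite exchange_big /=; apply: eq_bigr => s _; rewrite mulr_sumr.
  by apply: eq_bigr => p _; ring.
have -> : \sum_s q l s * covd Y i m s =
    \sum_s (q l s * D i (Y m s) - q l s * \sum_p chr p i m * Y p s)
    - \sum_s \sum_p chr s i p * q l p * Y m s.
  rewrite [X in _ - X]exchange_big -!sumrB /=; apply: eq_bigr => s _.
  rewrite /covd big_split /= mulrBr mulrDr opprD addrA; congr (_ - _).
  by rewrite mulr_sumr; apply: eq_bigr => p _; ring.
rewrite !sumrB addrA [RHS]addrAC; congr (_ - _).
rewrite -big_split -sumrB /=; apply: eq_bigr => s _.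
rewrite (derM (D_der i)) D_cometric big_split /= mulNr mulrDl -mulr_suml.
by ring.
Qed.

(** The second Bianchi identity, traced over i and l and then with the inverse
    metric over j and k.  The first and last terms are D_m R and minus the
    divergence of Ric.  In the middle one, [Q] is the Ricci tensor with one
    index raised: by antisymmetry in the last two indices the inverse metric
    traces the curvature to -Q, so that this term is again minus the divergence
    of Ric. *)
Lemma contracted_bianchi m :
  D m scal = 2%:R * \sum_j \sum_k q j k * covd ric j m k.
Proof.
pose Q l m := \sum_s q l s * ric m s.
have riemQ l s : \sum_j \sum_k q j k * riem l j s k = - Q l s.
  have E k : \sum_j q j k * riem l j s k
      = \sum_j \sum_r q k j * (q l r * (\sum_a g r a * riem a j s k)).
    apply: eq_bigr => j _; rewrite -mulr_sumr.
    by rewrite (contr_qg l (fun a => riem a j s k)) qC.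
  rewrite exchange_big /=; under eq_bigr do rewrite E.
  rewrite exchange_big /=.
  have -> : \sum_j \sum_k \sum_r q k j * (q l r * (\sum_a g r a * riem a j s k))
     = - \sum_r q l r * \sum_j \sum_k q j k * \sum_a g k a * riem a j s r.
    under eq_bigr do rewrite exchange_big /=.
    rewrite exchange_big /= -sumrN; apply: eq_bigr => r _.
    rewrite mulr_sumr -sumrN; apply: eq_bigr => j _.
    rewrite mulr_sumr -sumrN; apply: eq_bigr => k _.
    by rewrite (riem_anti34 r) (qC k j); ring.
  congr (- _); apply: eq_bigr => r _; congr (_ * _).
  by apply: eq_bigr => j _; rewrite (contr_qg j (fun a => riem a j s r)).
have divQ : \sum_i \sum_j \sum_k q j k * nriem i i j m k
    = - \sum_i \sum_s q i s * covd ric i m s.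
  rewrite -sumrN; apply: eq_bigr => i _; rewrite -covd_raise.
  have -> : \sum_j \sum_k q j k * nriem i i j m k
     = D i (\sum_j \sum_k q j k * riem i j m k)
       + \sum_p (chr i i p * (\sum_j \sum_k q j k * riem p j m k)
                - chr p i m * (\sum_j \sum_k q j k * riem i j p k)).
    rewrite trace_covd.
    have -> : \sum_p (chr i i p * (\sum_j \sum_k q j k * riem p j m k)
                - chr p i m * (\sum_j \sum_k q j k * riem i j p k))
      = \sum_j \sum_k q j k * \sum_p (chr i i p * riem p j m k - chr p i m * riem i j p k).
      under eq_bigr do rewrite !mulr_sumr -sumrB.
      rewrite exchange_big /=; apply: eq_bigr => j _.
      under eq_bigr do rewrite !mulr_sumr -sumrB.
      rewrite exchange_big /=; apply: eq_bigr => k _.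
      by rewrite mulr_sumr; apply: eq_bigr => p _; ring.
    rewrite -big_split; apply: eq_bigr => j _; rewrite -big_split.
    apply: eq_bigr => k _ /=; rewrite -mulrDr; congr (_ * _).
    rewrite /nriem /dcurv /covd -!addrA; congr (_ + _).
    by rewrite -!sumrN -!big_split /=; apply: eq_bigr => p _; ring.
  rewrite riemQ (derN (D_der i)) opprD -sumrN; congr (_ + _).
  by apply: eq_bigr => p _; rewrite !riemQ /Q; ring.
have /eqP : \sum_j \sum_k q j k *
   (\sum_i (nriem m i i j k + nriem i i j m k + nriem j i m i k)) = 0.
  rewrite big1 // => j _; rewrite big1 // => k _.
  by rewrite big1 ?mulr0 // => i _; rewrite second_bianchi.
have -> : \sum_j \sum_k q j k *
   (\sum_i (nriem m i i j k + nriem i i j m k + nriem j i m i k)) =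
   \sum_j \sum_k q j k * covd ric m j k
   + \sum_i \sum_j \sum_k q j k * nriem i i j m k
   - \sum_j \sum_k q j k * covd ric j m k.
  rewrite [X in _ + X - _]exchange_big -big_split -sumrB; apply: eq_bigr => j _ /=.
  rewrite [X in _ + X - _]exchange_big -big_split -sumrB; apply: eq_bigr => k _ /=.
  rewrite -mulr_sumr -mulrDr -mulrBr; congr (_ * _).
  rewrite big_split big_split /= trace_nriem; congr (_ + _ + _).
  by rewrite -trace_nriem -sumrN; apply: eq_bigr => i _; rewrite nriem_anti.
rewrite divQ -trace_covd -addrA -opprD subr_eq0 => /eqP ->.
by ring.
Qed.

(** * Evolution of the curvature under a flow of metrics *)

(** The time derivative; [h] is the variation of the metric. *)
Variable T : A -> A.
Hypothesis T_der : derivation T.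
Hypothesis T_comm : forall i a, T (D i a) = D i (T a).

Let h i j := T (g i j).

Lemma hC i j : h i j = h j i. Proof. by rewrite /h gC. Qed.

Lemma covdC (S : 'I_n -> 'I_n -> A) :
  (forall i j, S i j = S j i) -> forall i j k, covd S i j k = covd S i k j.
Proof.
move=> SC i j k; rewrite /covd (SC j k); congr (_ - _).
by apply: eq_bigr => p _; rewrite addrC (SC p k) (SC j p).
Qed.

Lemma T_chr_low m i j :
  T (chr_low m i j) = half * (D i (h j m) + D j (h i m) - D m (h i j)).
Proof.
rewrite /chr_low (derMc T_der _ (der_half T_der half2)).
by rewrite (derB T_der) (derD T_der) !T_comm.
Qed.

(** Differentiate g_mk Gamma^k_ij = Gamma_m,ij in time and compare with the
    covariant derivatives of h: expanding those produces the term
    h_mk Gamma^k_ij twice, with the factor 1/2. *)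
Lemma T_chr k i j : T (chr k i j) =
  half * \sum_l q k l * (covd h i j l + covd h j i l - covd h l i j).
Proof.
rewrite mulr_sumr; under [RHS]eq_bigr do rewrite mulrCA.
move: k; apply: lowering_inj => m.
rewrite (contr_gq m (fun l => half * (covd h i j l + covd h j i l - covd h l i j))).
have e : T (chr_low m i j) = \sum_k h m k * chr k i j + \sum_k g m k * T (chr k i j).
  rewrite chr_lowE (der_sum T_der) -big_split /=.
  by apply: eq_bigr => p _; rewrite (derM T_der).
apply: (addrI (\sum_k h m k * chr k i j)); rewrite -e T_chr_low.
rewrite /covd.
set u := D i (h j m); set v := D j (h i m); set w := D m (h i j).
have -> : u - \sum_p (chr p i j * h p m + chr p i m * h j p)
   + (v - \sum_p (chr p j i * h p m + chr p j m * h i p))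
   - (w - \sum_p (chr p m i * h p j + chr p m j * h i p))
   = u + v - w - (\sum_k h m k * chr k i j + \sum_k h m k * chr k i j).
  have -> : \sum_k h m k * chr k i j + \sum_k h m k * chr k i j =
    \sum_p (chr p i j * h p m + chr p i m * h j p)
   + \sum_p (chr p j i * h p m + chr p j m * h i p)
   - \sum_p (chr p m i * h p j + chr p m j * h i p).
    rewrite -!big_split -sumrB /=; apply: eq_bigr => p _.
    rewrite (chrC p j i) (chrC p m i) (chrC p m j).
    by rewrite (hC m p) (hC p j); ring.
  by ring.
set S := \sum_k h m k * chr k i j.
have -> : S + half * (u + v - w - (S + S))
   = S - (half * S + half * S) + half * (u + v - w) by ring.
by rewrite halfE subrr add0r.
Qed.

Lemma T_cometric i j : T (q i j) = - \sum_a \sum_b q i a * h a b * q b j.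
Proof.
move: i; apply: lowering_inj => m.
have /eqP : T (\sum_a g m a * q a j) = 0 by rewrite gq (der_nat T_der).
rewrite (der_sum T_der); under eq_bigr do rewrite (derM T_der).
rewrite big_split /= addrC addr_eq0 => /eqP ->.
under [RHS]eq_bigr do rewrite mulrN.
rewrite sumrN; congr (- _).
rewrite -[LHS](contr_gq m (fun a => \sum_b h a b * q b j)).
apply: eq_bigr => k _; congr (_ * _); apply: eq_bigr => a _.
by rewrite mulr_sumr; apply: eq_bigr => b _; rewrite mulrA.
Qed.

(** Palatini's identity: d_t Ric_jk = nabla_i C^i_jk - nabla_j C^i_ik for
    C = d_t Gamma, where the first covariant derivative is written as [covd] of
    the slice C^i together with the correction of the index i. *)
Lemma T_ric j k : T (ric j k) =
  \sum_i (covd (fun j k => T (chr i j k)) i j k + \sum_p chr i i p * T (chr p j k))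
  - (D j (\sum_i T (chr i i k)) - \sum_p chr p j k * \sum_i T (chr i i p)).
Proof.
pose C i j k := T (chr i j k).
pose s1 := \sum_i \sum_p chr i i p * C p j k.
pose s2 := \sum_i \sum_p C i i p * chr p j k.
pose s3 := \sum_i \sum_p chr i j p * C p i k.
pose s4 := \sum_i \sum_p C i j p * chr p i k.
have -> : T (ric j k) =
    \sum_i D i (C i j k) - \sum_i D j (C i i k) + (s1 + s2 - (s3 + s4)).
  rewrite (der_sum T_der) -!big_split -!sumrB -big_split /=; apply: eq_bigr => i _.
  rewrite -!big_split -sumrB /= /riem (derD T_der) (derB T_der) (der_sum T_der) !T_comm.
  congr (_ + _); apply: eq_bigr => p _.
  by rewrite (derB T_der) (derM T_der (chr i i p)) (derM T_der (chr i j p)) /C; ring.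
have -> : \sum_i (covd (fun j k => T (chr i j k)) i j k
      + \sum_p chr i i p * T (chr p j k)) =
    \sum_i D i (C i j k) + s1 - (s3 + s4).
  have -> : s3 = \sum_i \sum_p chr p i j * C i p k.
    rewrite /s3 exchange_big; apply: eq_bigr => i _; apply: eq_bigr => p _.
    by rewrite (chrC p i j).
  rewrite -!big_split -!sumrB /=; apply: eq_bigr => i _.
  rewrite /covd -/(C i) addrAC; congr (_ + _ - _).
  by rewrite -big_split; apply: eq_bigr => p _ /=; rewrite [C i j p * _]mulrC.
have -> : \sum_p chr p j k * \sum_i T (chr i i p) = s2.
  rewrite /s2 exchange_big; apply: eq_bigr => p _; rewrite mulr_sumr.
  by apply: eq_bigr => i _; rewrite mulrC.
by rewrite (der_sum (D_der j)) -/C; ring.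
Qed.

Section Flow.
Variables al be : A.
Hypothesis Dal : forall i, D i al = 0.
Hypothesis Dbe : forall i, D i be = 0.
Hypothesis flow : forall i j,
  T (g i j) = - (2%:R * al) * ric i j - (be * scal) * g i j.

Let rC : forall i j, ric i j = ric j i.
Proof. exact: ricC. Qed.

Lemma covd_flow i j k :
  covd h i j k = - (2%:R * al) * covd ric i j k - be * D i scal * g j k.
Proof.
rewrite /covd /h.
have -> : \sum_p (chr p i j * T (g p k) + chr p i k * T (g j p)) =
  - (2%:R * al) * \sum_p (chr p i j * ric p k + chr p i k * ric j p)
  - be * scal * \sum_p (chr p i j * g p k + chr p i k * g j p).
  rewrite [X in _ = X - _]mulr_sumr [X in _ = _ - X]mulr_sumr -sumrB.
  by apply: eq_bigr => p _; rewrite !flow; ring.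
rewrite flow (derB (D_der i)).
rewrite (derMc (D_der i) (ric j k)); last first.
  by rewrite (derN (D_der i)) (derMc (D_der i) _ (der_nat (D_der i) 2)) Dal mulr0 oppr0.
rewrite (derM (D_der i) (be * scal)) (derMc (D_der i) scal (Dbe i)).
by rewrite D_metric; ring.
Qed.

(** Substitute h = -2 alpha Ric - beta R g in T_chr. *)
Theorem flow_christoffel k i j : T (chr k i j) =
  al * (\sum_l q k l * (covd ric l i j - covd ric i j l - covd ric j i l))
  - be * half * (D i scal * (k == j)%:R + D j scal * (k == i)%:R
                 - gradient scal k * g i j).
Proof.
rewrite T_chr.
have -> : \sum_l q k l * (covd h i j l + covd h j i l - covd h l i j)
  = (al + al) * (\sum_l q k l * (covd ric l i j - covd ric i j l - covd ric j i l))
    - be * (D i scal * (\sum_l q k l * g l j) + D j scal * (\sum_l q k l * g l i)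
                 - gradient scal k * g i j).
  rewrite /gradient mulr_suml !mulr_sumr -big_split -sumrB mulr_sumr -sumrB /=.
  apply: eq_bigr => l _; rewrite !covd_flow (gC l j) (gC l i); ring.
rewrite !qg mulrBr; congr (_ - _); last by ring.
by rewrite mulrDl mulrDr halfE.
Qed.

Let qg_trace : \sum_j \sum_k q j k * g j k = n%:R.
Proof.
transitivity (\sum_(j < n) (1 : A)); last by rewrite sumr_const card_ord.
apply: eq_bigr => j _; transitivity (\sum_k q j k * g k j).
  by apply: eq_bigr => k _; rewrite (gC j).
by rewrite qg eqxx.
Qed.

Lemma trace_metric_flow : \sum_j \sum_k q j k * T (g j k) = - (2%:R * al + n%:R * be) * scal.
Proof.
have -> : \sum_j \sum_k q j k * T (g j k)
    = - (2%:R * al) * (\sum_j \sum_k q j k * ric j k)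
      - (be * scal) * \sum_j \sum_k q j k * g j k.
  rewrite [X in _ = X - _]mulr_sumr [X in _ = _ - X]mulr_sumr -sumrB.
  apply: eq_bigr => j _.
  rewrite [X in _ = X - _]mulr_sumr [X in _ = _ - X]mulr_sumr -sumrB.
  by apply: eq_bigr => k _; rewrite flow; ring.
by rewrite qg_trace -/scal; ring.
Qed.

Lemma div_ric l : 2%:R * \sum_j \sum_k q j k * covd ric j k l = D l scal.
Proof.
rewrite contracted_bianchi; congr (_ * _).
apply: eq_bigr => j _; apply: eq_bigr => k _; by rewrite (covdC rC).
Qed.

(** The terms in alpha cancel: by the contracted Bianchi identity they are
    nabla R - 2 div Ric = 0. *)
Lemma trace_T_chr_up i : \sum_j \sum_k q j k * T (chr i j k) =
  be * half * (n%:R - 2%:R) * gradient scal i.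
Proof.
have -> : \sum_j \sum_k q j k * T (chr i j k) =
   al * (\sum_l q i l * ((\sum_j \sum_k q j k * covd ric l j k)
         - 2%:R * (\sum_j \sum_k q j k * covd ric j k l)))
   - be * half * (2%:R * gradient scal i - n%:R * gradient scal i).
  rewrite -qg_trace.
  have -> : 2%:R * gradient scal i = \sum_j \sum_k q j k * (D j scal * (i == k)%:R + D k scal * (i == j)%:R).
    have -> : \sum_j \sum_k q j k * (D j scal * (i == k)%:R + D k scal * (i == j)%:R)
       = \sum_j \sum_k (i == k)%:R * (q j k * D j scal)
       + \sum_j \sum_k (i == j)%:R * (q j k * D k scal).
      rewrite -big_split; apply: eq_bigr => j _; rewrite -big_split.
      by apply: eq_bigr => k _ /=; ring.
    under eq_bigr do rewrite sum_delta.
    rewrite [X in _ + X]exchange_big /=; under [X in _ + X]eq_bigr do rewrite sum_delta.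
    rewrite -big_split mulr_sumr; apply: eq_bigr => l _ /=.
    by rewrite (qC l i); ring.
  have -> : \sum_l q i l * ((\sum_j \sum_k q j k * covd ric l j k)
         - 2%:R * (\sum_j \sum_k q j k * covd ric j k l))
    = \sum_j \sum_k q j k * (\sum_l q i l * (covd ric l j k - covd ric j k l - covd ric k j l)).
    have -> : \sum_j \sum_k q j k * (\sum_l q i l * (covd ric l j k - covd ric j k l - covd ric k j l))
      = \sum_l q i l * \sum_j \sum_k q j k * (covd ric l j k - covd ric j k l - covd ric k j l).
      under [RHS]eq_bigr do rewrite mulr_sumr.
      rewrite [RHS]exchange_big /=; apply: eq_bigr => j _.
      under [RHS]eq_bigr do rewrite mulr_sumr.
      rewrite [RHS]exchange_big /=; apply: eq_bigr => k _.
      by rewrite mulr_sumr; apply: eq_bigr => l _; ring.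
    apply: eq_bigr => l _; congr (_ * _).
    have -> : 2%:R * (\sum_j \sum_k q j k * covd ric j k l)
       = \sum_j \sum_k q j k * covd ric j k l + \sum_j \sum_k q j k * covd ric k j l.
      rewrite [X in _ + X]exchange_big /= -big_split mulr_sumr; apply: eq_bigr => j _ /=.
      rewrite -big_split mulr_sumr; apply: eq_bigr => k _ /=.
      by rewrite (qC k j); ring.
    rewrite -big_split -sumrB; apply: eq_bigr => j _ /=.
    rewrite -big_split -sumrB; apply: eq_bigr => k _ /=; ring.
  rewrite [X in _ - _ * (_ - X)]mulr_suml -sumrB !mulr_sumr -sumrB; apply: eq_bigr => j _.
  rewrite [X in _ - _ * (_ - X)]mulr_suml -sumrB !mulr_sumr -sumrB; apply: eq_bigr => k _.
  by rewrite flow_christoffel; ring.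
under eq_bigr do rewrite div_ric -trace_covd subrr mulr0.
by rewrite big1 //; ring.
Qed.

(** Here the two divergence terms of Ric cancel by symmetry, and the trace of
    nabla_k Ric is D_k R. *)
Lemma trace_T_chr_down k : \sum_i T (chr i i k) = - (al + n%:R * (be * half)) * D k scal.
Proof.
have -> : \sum_i T (chr i i k) =
   al * ((\sum_i \sum_l q i l * covd ric l i k) - (\sum_i \sum_l q i l * covd ric i k l)
         - (\sum_i \sum_l q i l * covd ric k i l))
   - be * half * (\sum_i ((i == k)%:R * D i scal) + \sum_(i < n) D k scal
        - (\sum_i gradient scal i * g i k)).
  rewrite -!sumrB -!big_split -sumrB !mulr_sumr -sumrB /=; apply: eq_bigr => i _.
  rewrite flow_christoffel eqxx -!sumrB; congr (_ * _ - _); last by rewrite /=; ring.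
  by apply: eq_bigr => l _; ring.
rewrite -trace_covd -/scal.
have -> : \sum_i \sum_l q i l * covd ric l i k = \sum_i \sum_l q i l * covd ric i k l.
  rewrite exchange_big; apply: eq_bigr => i _; apply: eq_bigr => l _ /=.
  by rewrite (qC l) (covdC rC).
have -> : \sum_i ((i == k)%:R * D i scal) = D k scal.
  rewrite -[RHS](sum_delta k (fun i => D i scal)); by apply: eq_bigr => i _; rewrite eq_sym.
have -> : \sum_i gradient scal i * g i k = D k scal.
  rewrite -[RHS](contr_gq k (fun l => D l scal)).
  by apply: eq_bigr => i _; rewrite mulrC (gC i).
by rewrite sumr_const card_ord -mulr_natl; ring.
Qed.

(** The derivative of the inverse metric gives the quadratic terms.  In the
    trace of d_t Ric, metric compatibility moves the inverse metric inside the
    divergences, and with the two traces of d_t Gamma, equal to [c] and [c']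
    times the gradient of R, it becomes (c - c') times the Laplacian of R. *)
Theorem flow_scal : T scal =
  (al + (n%:R - 1) * be) * lapl scal
  + 2%:R * al * (\sum_i \sum_j \sum_k \sum_l q i k * q j l * ric i j * ric k l)
  + be * scal ^+ 2.
Proof.
have Dh i : D i half = 0 by apply: (der_half (D_der i)); exact: half2.
have -> : T scal = \sum_i \sum_j T (q i j) * ric i j + \sum_i \sum_j q i j * T (ric i j).
  rewrite (der_sum T_der) -big_split; apply: eq_bigr => i _ /=.
  rewrite (der_sum T_der) -big_split; apply: eq_bigr => j _ /=; exact: (derM T_der).
have -> : \sum_i \sum_j T (q i j) * ric i j =
   2%:R * al * (\sum_i \sum_j \sum_k \sum_l q i k * q j l * ric i j * ric k l)
   + be * scal ^+ 2.
  have E i j : T (q i j) = 2%:R * al * (\sum_k \sum_l q i k * q j l * ric k l) + be * scal * q i j.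
    rewrite T_cometric.
    have -> : q i j = \sum_k \sum_l q i k * g k l * q l j.
      rewrite -[LHS](contr_qg i (fun k => q k j)); apply: eq_bigr => k _.
      by rewrite mulr_sumr; apply: eq_bigr => l _; rewrite mulrA.
    rewrite [X in _ = X + _]mulr_sumr [X in _ = _ + X]mulr_sumr -big_split -sumrN.
    apply: eq_bigr => k _ /=.
    rewrite [X in _ = X + _]mulr_sumr [X in _ = _ + X]mulr_sumr -big_split -sumrN.
    apply: eq_bigr => l _ /=.
    by rewrite /h flow (qC l j); ring.
  rewrite expr2 mulrA.
  have -> : be * scal * scal = be * scal * \sum_i \sum_j q i j * ric i j by [].
  rewrite [X in _ = X + _]mulr_sumr [X in _ = _ + X]mulr_sumr -big_split.
  apply: eq_bigr => i _ /=.
  rewrite [X in _ = X + _]mulr_sumr [X in _ = _ + X]mulr_sumr -big_split.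
  apply: eq_bigr => j _ /=.
  rewrite E mulrDl mulrA; congr (_ + _); rewrite -mulrA; congr (_ * _).
  rewrite mulr_suml; apply: eq_bigr => k _; rewrite mulr_suml; apply: eq_bigr => l _; ring.
have -> : \sum_i \sum_j q i j * T (ric i j) =
  \sum_i (D i (\sum_j \sum_k q j k * T (chr i j k)) + \sum_p chr i i p * (\sum_j \sum_k q j k * T (chr p j k)))
  - \sum_j \sum_k q j k * (D j (\sum_i T (chr i i k)) - \sum_p chr p j k * \sum_i T (chr i i p)).
  have -> : \sum_i (D i (\sum_j \sum_k q j k * T (chr i j k)) + \sum_p chr i i p * (\sum_j \sum_k q j k * T (chr p j k)))
    = \sum_j \sum_k q j k * \sum_i (covd (fun j k => T (chr i j k)) i j k + \sum_p chr i i p * T (chr p j k)).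
    under eq_bigr do rewrite trace_covd.
    have -> : \sum_j \sum_k q j k * \sum_i (covd (fun j k => T (chr i j k)) i j k + \sum_p chr i i p * T (chr p j k))
     = \sum_i \sum_j \sum_k q j k * (covd (fun j k => T (chr i j k)) i j k + \sum_p chr i i p * T (chr p j k)).
      rewrite [RHS]exchange_big; apply: eq_bigr => j _; rewrite [RHS]exchange_big.
      by apply: eq_bigr => k _; rewrite mulr_sumr.
    apply: eq_bigr => i _.
    have -> : \sum_p chr i i p * (\sum_j \sum_k q j k * T (chr p j k))
       = \sum_j \sum_k q j k * \sum_p chr i i p * T (chr p j k).
      under eq_bigr do rewrite mulr_sumr.
      rewrite exchange_big; apply: eq_bigr => j _ /=.
      under eq_bigr do rewrite mulr_sumr.
      rewrite exchange_big; apply: eq_bigr => k _ /=; rewrite mulr_sumr.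
      by apply: eq_bigr => p _; ring.
    rewrite -big_split; apply: eq_bigr => j _; rewrite -big_split; apply: eq_bigr => k _ /=; ring.
  rewrite -sumrB; apply: eq_bigr => i _; rewrite -sumrB; apply: eq_bigr => j _.
  by rewrite T_ric; ring.
set c := be * half * (n%:R - 2%:R); set c' := - (al + n%:R * (be * half)).
have Dc i : D i c = 0.
  rewrite /c (derM (D_der i)) (derM (D_der i)) Dbe Dh (derB (D_der i)) !(der_nat (D_der i)); ring.
have Dc' i : D i c' = 0.
  rewrite /c' (derN (D_der i)) (derD (D_der i)) Dal (derM (D_der i)) (der_nat (D_der i)) (derM (D_der i)) Dbe Dh; ring.
have -> : \sum_i (D i (\sum_j \sum_k q j k * T (chr i j k)) + \sum_p chr i i p * (\sum_j \sum_k q j k * T (chr p j k)))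
   = c * lapl scal.
  under eq_bigr => i _.
    rewrite trace_T_chr_up (derMc (D_der i) _ (Dc i)).
    under eq_bigr do rewrite trace_T_chr_up mulrCA.
    rewrite -mulr_sumr -mulrDr.
    over.
  rewrite -mulr_sumr; congr (_ * _).
  have E i : D i (gradient scal i) =
     \sum_l q i l * D i (D l scal)
     - (\sum_l \sum_p chr i i p * q p l * D l scal + \sum_l \sum_p chr l i p * q i p * D l scal).
    rewrite (der_sum (D_der i)) -big_split -sumrB; apply: eq_bigr => l _ /=.
    rewrite (derM (D_der i)) D_cometric big_split /=.
    by rewrite -!mulr_suml; ring.
  have E' i : D i (gradient scal i) + \sum_p chr i i p * gradient scal p =
     \sum_l q i l * D i (D l scal) - \sum_l \sum_p chr l i p * q i p * D l scal.
    rewrite E; have -> : \sum_p chr i i p * gradient scal p = \sum_l \sum_p chr i i p * q p l * D l scal.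
      rewrite exchange_big; apply: eq_bigr => p _; rewrite mulr_sumr; by apply: eq_bigr => l _; rewrite mulrA.
    by ring.
  apply: eq_bigr => i _; rewrite E'.
  rewrite [X in _ - X]exchange_big -sumrB; apply: eq_bigr => l _ /=.
  by rewrite mulrBr mulr_sumr; congr (_ - _); apply: eq_bigr => p _; ring.
have -> : \sum_j \sum_k q j k * (D j (\sum_i T (chr i i k)) - \sum_p chr p j k * \sum_i T (chr i i p))
   = c' * lapl scal.
  rewrite mulr_sumr; apply: eq_bigr => j _; rewrite mulr_sumr; apply: eq_bigr => k _.
  rewrite trace_T_chr_down -/c' (derMc (D_der j) _ (Dc' j)).
  under eq_bigr do rewrite trace_T_chr_down -/c' mulrCA.
  by rewrite -mulr_sumr; ring.
have -> : al + (n%:R - 1) * be = c - c'.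
  have -> : (n%:R - 1) * be = (half + half) * ((n%:R - 1) * be) by rewrite half2 mul1r.
  by rewrite /c /c'; ring.
by ring.
Qed.

End Flow.
End Curvature.

(** * Surfaces and Einstein tensors *)

Lemma sum_ord2 (V : nmodType) (F : 'I_2 -> V) : \sum_i F i = F 0 + F 1.
Proof.
by rewrite !big_ord_recl big_ord0 addr0; congr (_ + F _); apply: val_inj.
Qed.

Lemma ord2P (P : 'I_2 -> Prop) : P 0 -> P 1 -> forall i, P i.
Proof.
move=> P0 P1 [[|[|//]] i2].
- by rewrite (_ : Ordinal i2 = 0) //; apply: val_inj.
- by rewrite (_ : Ordinal i2 = 1) //; apply: val_inj.
Qed.

Section Surface.
Context {A : comPzRingType}.
Variables (D : 'I_2 -> A -> A) (half : A) (g q : 'I_2 -> 'I_2 -> A).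
Hypothesis D_der : forall i, derivation (D i).
Hypothesis D_comm : forall i j a, D i (D j a) = D j (D i a).
Hypothesis half2 : half + half = 1.
Hypothesis gC : forall i j, g i j = g j i.
Hypothesis qC : forall i j, q i j = q j i.
Hypothesis gq : forall i j, \sum_k g i k * q k j = (i == j)%:R.

Local Notation riem := (riem D half g q).
Local Notation ric := (ric D half g q).

Let det2 := g 0 0 * g 1 1 - g 0 1 ^+ 2.

Lemma cometric2 :
  [/\ det2 * q 0 0 = g 1 1, det2 * q 0 1 = - g 0 1 & det2 * q 1 1 = g 0 0].
Proof.
have e a b : g a 0 * q 0 b + g a 1 * q 1 b = (a == b)%:R.
  by rewrite -(sum_ord2 (fun c => g a c * q c b)) gq.
have e00 : g 0 0 * q 0 0 + g 0 1 * q 0 1 = 1 by rewrite (qC 0 1) e.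
have e01 : g 0 0 * q 0 1 + g 0 1 * q 1 1 = 0 by rewrite e.
have e10 : g 0 1 * q 0 0 + g 1 1 * q 0 1 = 0 by rewrite (qC 0 1) (gC 0 1) e.
have e11 : g 0 1 * q 0 1 + g 1 1 * q 1 1 = 1 by rewrite (gC 0 1) e.
have dq11 : det2 * q 1 1 = g 0 0.
  transitivity (g 0 0 * (g 0 1 * q 0 1 + g 1 1 * q 1 1)
    - g 0 1 * (g 0 0 * q 0 1 + g 0 1 * q 1 1)); first by rewrite /det2; ring.
  by rewrite e11 e01 mulr1 mulr0 subr0.
have dq00 : det2 * q 0 0 = g 1 1.
  transitivity (g 1 1 * (g 0 0 * q 0 0 + g 0 1 * q 0 1)
    - g 0 1 * (g 0 1 * q 0 0 + g 1 1 * q 0 1)); first by rewrite /det2; ring.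
  by rewrite e00 e10 mulr1 mulr0 subr0.
have dq01 : det2 * q 0 1 = - g 0 1.
  transitivity (g 1 1 * (g 0 0 * q 0 1 + g 0 1 * q 1 1)
    - g 0 1 * (g 0 1 * q 0 1 + g 1 1 * q 1 1)); first by rewrite /det2; ring.
  by rewrite e11 e01 mulr1 mulr0 sub0r.
by [].
Qed.

(** The two antisymmetries leave a single independent component [L] of the
    lowered curvature tensor, so that Ric is L times the cofactor matrix of the
    inverse metric, which is g divided by det g. *)
Lemma surface_ric j k : det2 * ric j k
  = (\sum_l g l 0 * riem l 0 1 1) * g j k.
Proof.
pose low s i j k := \sum_l g s l * riem l i j k.
have low12 s i j' k' : low s j' i k' = - low s i j' k'.
  by rewrite -sumrN; apply: eq_bigr => l _; rewrite riem_anti12 mulrN.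
have low34 s i j' k' : low s i j' k' = - low k' i j' s.
  exact: (riem_anti34 D_der D_comm half2 gC gq).
have low0 s i k' : low s i i k' = 0.
  by apply: (double_inj half2); rewrite {1}low12 addNr addr0.
have low0' s i j' : low s i j' s = 0.
  by apply: (double_inj half2); rewrite {1}low34 addNr addr0.
have ricE a b : ric a b = \sum_i \sum_s q i s * low s i a b.
  apply: eq_bigr => i _.
  by rewrite (contr_qg gC qC gq i (fun l => riem l i a b)).
have -> : \sum_l g l 0 * riem l 0 1 1 = low 0 0 1 1.
  by apply: eq_bigr => l _; rewrite gC.
set L := low 0 0 1 1; rewrite {}ricE !sum_ord2.
have l1100 : low 1 1 0 0 = L by rewrite low12 low34 opprK.
have l0101 : low 0 1 0 1 = - L by rewrite low12.
have l1010 : low 1 0 1 0 = - L by rewrite low34.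
have [dq00 dq01 dq11] := cometric2; rewrite -/det2.
move: k; apply: ord2P; move: j; apply: ord2P; rewrite ?low0 ?low0'.
- by rewrite l1100 !mulr0 !add0r mulrA dq11 mulrC.
- by rewrite l1010 !mulr0 addr0 add0r addr0 mulrA dq01 (gC 1 0); ring.
- by rewrite l0101 !mulr0 !add0r addr0 (qC 1 0) mulrA dq01; ring.
- by rewrite -/L !mulr0 !addr0 mulrA dq00 mulrC.
Qed.
End Surface.

Lemma lapl_scale (A : comPzRingType) n (D : 'I_n -> A -> A) (h : A)
    (g q : 'I_n -> 'I_n -> A) (c u : A) :
  (forall i, derivation (D i)) -> (forall i, D i c = 0) ->
  lapl D h g q (c * u) = c * lapl D h g q u.
Proof.
move=> D_der Dc; rewrite mulr_sumr; apply: eq_bigr => i _; rewrite mulr_sumr.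
apply: eq_bigr => j _; rewrite mulrCA; congr (_ * _).
rewrite (derMc (D_der j) u (Dc j)) (derMc (D_der i) _ (Dc i)) mulrBr mulr_sumr.
by congr (_ - _); apply: eq_bigr => k _; rewrite (derMc (D_der k) u (Dc k)) mulrCA.
Qed.

Section Einstein.
Context {A : comPzRingType} {n : nat}.
Variables (g q S : 'I_n -> 'I_n -> A) (K : A).
Hypothesis gC : forall i j, g i j = g j i.
Hypothesis qC : forall i j, q i j = q j i.
Hypothesis gq : forall i j, \sum_k g i k * q k j = (i == j)%:R.
Hypothesis SE : forall i j, S i j = K * g i j.

Lemma einstein_trace : \sum_i \sum_j q i j * S i j = n%:R * K.
Proof.
transitivity (\sum_(i < n) K); last by rewrite sumr_const card_ord mulr_natl.
apply: eq_bigr => i _; rewrite -[RHS]mulr1.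
have <- : \sum_k q i k * g k i = 1 by rewrite (qg gC qC gq) eqxx.
by rewrite mulr_sumr; apply: eq_bigr => k _; rewrite SE (gC k); ring.
Qed.

Lemma einstein_norm :
  \sum_i \sum_j \sum_k \sum_l q i k * q j l * S i j * S k l = n%:R * K ^+ 2.
Proof.
have E i j : \sum_k \sum_l q i k * q j l * S k l = K * q i j.
  rewrite -(contr_qg gC qC gq i (fun l => q l j)) mulr_sumr.
  apply: eq_bigr => k _; rewrite !mulr_sumr; apply: eq_bigr => l _.
  by rewrite SE (qC j l); ring.
transitivity (\sum_i \sum_j q i j * S i j * K).
  apply: eq_bigr => i _; apply: eq_bigr => j _.
  transitivity (S i j * \sum_k \sum_l q i k * q j l * S k l).
    by rewrite mulr_sumr; apply: eq_bigr => k _; rewrite mulr_sumr; apply: eq_bigr => l _; ring.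
  by rewrite E; ring.
under eq_bigr do rewrite -mulr_suml.
by rewrite -mulr_suml einstein_trace; ring.
Qed.
End Einstein.

(** * Mean value theorems along lines *)

Section Lines.
Context {R : realType} {V W : normedModType R}.

Lemma is_derive_line (f : V -> W) (x v : V) (s : R) :
  derivable f (x + s *: v) v ->
  is_derive s 1 (fun r : R => f (x + r *: v)) ('D_v f (x + s *: v)).
Proof.
have E : (fun h : R => h^-1 *: (((fun r : R => f (x + r *: v)) \o shift s) (h *: (1 : R))
            - f (x + s *: v))) =
    (fun h : R => h^-1 *: ((f \o shift (x + s *: v)) (h *: v) - f (x + s *: v))).
  apply/funext => h /=; congr (_ *: (f _ - _)).
  by rewrite [h *: 1]mulr1 scalerDl addrCA.
by move=> d; split; [rewrite /derivable E | rewrite /derive E].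
Qed.
End Lines.

Section MeanValue.
Context {R : realType} {V : normedModType R}.
Implicit Types (f : V -> R) (x v w : V).

(** The strict bounds on the intermediate point are what makes the second
    derivative test at a minimum work. *)
Lemma line_mvt f x v (h : R) : 0 < h ->
  (forall s, s \in `[0, h] -> derivable f (x + s *: v) v) ->
  exists2 s, s \in `]0, h[ & f (x + h *: v) - f x = h * 'D_v f (x + s *: v).
Proof.
move=> h0 df; have dl s : s \in `[0, h] ->
    is_derive s 1 (fun r => f (x + r *: v)) ('D_v f (x + s *: v)).
  by move=> sh; apply/is_derive_line/df.
have H1 s : s \in `]0, h[%R ->
    is_derive s 1 (fun r => f (x + r *: v)) ('D_v f (x + s *: v)).
  by rewrite in_itv /= => /andP[s0 sh]; apply: dl; rewrite in_itv /= !ltW.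
have H2 : {within `[0, h], continuous (fun r : R => f (x + r *: v))}.
  by apply: derivable_within_continuous => s /dl [].
have [s sh] := MVT h0 H1 H2.
by rewrite scale0r addr0 subr0 mulrC => e; exists s.
Qed.

Lemma nbhs_parallelogram (A : set V) x v w : nbhs x A ->
  exists2 h : R, 0 < h &
    forall s t, s \in `[0, h] -> t \in `[0, h] -> A (x + s *: v + t *: w).
Proof.
case/nbhs_ballP => e /= e0 eA.
have k0 : 0 < 1 + `|v| + `|w| by rewrite -addrA ltr_pwDl // addr_ge0.
have h0 : 0 < e / (1 + `|v| + `|w|) / 2 by rewrite !divr_gt0.
exists (e / (1 + `|v| + `|w|) / 2) => // s t.
rewrite !in_itv /= => /andP[s0 sh] /andP[t0 th]; apply: eA.
rewrite -ball_normE /= -addrA opprD addrA subrr sub0r normrN.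
apply: (le_lt_trans (ler_normD _ _)); rewrite !normrZ !ger0_norm //.
set h := e / _ / 2 in h0 sh th *.
apply: (@le_lt_trans _ _ (h * (1 + `|v| + `|w|))).
  rewrite -addrA mulrDr mulr1 mulrDr; apply: ler_wpDl; first exact: ltW.
  by apply: lerD; apply: ler_wpM2r.
by rewrite /h mulrAC divfK ?gt_eqF // ltr_pdivrMr // ltr_pMr // ltr1n.
Qed.

(** The mean value theorem twice, first along v for the difference of f under
    the translation by h w, then along w. *)
Lemma second_difference (U : set V) f x v w (h : R) : 0 < h ->
  (forall s t, s \in `[0, h] -> t \in `[0, h] -> U (x + s *: v + t *: w)) ->
  smooth_open U f ->
  exists s t, [/\ s \in `[0, h], t \in `[0, h] &
    f (x + h *: v + h *: w) - f (x + h *: v) - (f (x + h *: w) - f x)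
    = h ^+ 2 * 'D_w ('D_v f) (x + s *: v + t *: w)].
Proof.
move=> h0 hU sf.
have i0 : 0 \in `[0, h] by rewrite in_itv /= lexx ltW.
have ih : h \in `[0, h] by rewrite in_itv /= lexx ltW.
pose phi y := f (y + h *: w) - f y.
have dphi s : s \in `[0, h] -> is_derive (x + s *: v) v phi
    ('D_v f (x + s *: v + h *: w) - 'D_v f (x + s *: v)).
  move=> sh; apply: is_deriveB; last first.
    apply: derivableP.
    by have /(sf [::])[_] := hU s 0 sh i0; rewrite /= scale0r addr0; apply.
  have d1 : derivable f (x + s *: v + h *: w) v.
    by have /(sf [::])[_ /=] := hU s h sh ih; apply.
  have E : (fun k : R => k^-1 *: (((fun y => f (y + h *: w)) \o shift (x + s *: v)) (k *: v)
            - f (x + s *: v + h *: w))) =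
    (fun k : R => k^-1 *: ((f \o shift (x + s *: v + h *: w)) (k *: v) - f (x + s *: v + h *: w))).
    by apply/funext => k /=; rewrite !addrA.
  by split; [rewrite /derivable E | rewrite /derive E].
have [s sh e1] := line_mvt h0 (fun s sh => @ex_derive _ _ _ _ _ _ _ (dphi s sh)).
have {}sh := subset_itv_oo_cc sh.
have [t th e2] : exists2 t, t \in `]0, h[ & 'D_v f (x + s *: v + h *: w) - 'D_v f (x + s *: v)
   = h * 'D_w ('D_v f) (x + s *: v + t *: w).
  apply: (@line_mvt ('D_v f) (x + s *: v) w h h0) => t th.
  by have /(sf [:: v])[_ /=] := hU s t sh th; apply.
exists s, t; split => //; first exact: subset_itv_oo_cc.
by rewrite -/(phi (x + h *: v)) -/(phi x) e1 (@derive_val _ _ _ _ _ _ _ (dphi s sh)) e2 expr2 mulrA.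
Qed.

Lemma close_to_common (a b c e : R) : `|a - c| < e / 2 -> `|b - c| < e / 2 -> `|a - b| <= e.
Proof.
move=> ac bc; rewrite -(subrKA c) (le_trans (ler_normD _ _)) //.
by rewrite (splitr e) lerD // ltW // distrC.
Qed.

(** Schwarz: the second difference of f is symmetric in v and w, so h^2 times
    each mixed derivative, at points tending to x with h, is the same
    number. *)
Lemma derive_commute (U : set V) f x v w : open U -> U x -> smooth_open U f ->
  'D_v ('D_w f) x = 'D_w ('D_v f) x.
Proof.
move=> oU Ux sf; apply/eqP; rewrite -subr_eq0 -normr_le0; apply/ler_addgt0Pl => e e0.
rewrite addr0.
have c1 := (sf [:: v; w] x Ux).1; have c2 := (sf [:: w; v] x Ux).1.
have e20 : 0 < e / 2 by rewrite divr_gt0.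
move/cvgrPdist_lt/(_ _ e20) : c1; move/cvgrPdist_lt/(_ _ e20) : c2 => /= n2 n1.
have nU : nbhs x U by exact: open_nbhs_nbhs.
have [h h0 H] := nbhs_parallelogram v w (filterI nU (filterI n1 n2)).
have [s [t [sh th e1]]] := second_difference h0 (fun s t sh th => (H s t sh th).1) sf.
have H' s' t' : s' \in `[0, h] -> t' \in `[0, h] -> U (x + s' *: w + t' *: v).
  by move=> s'h t'h; rewrite addrAC; exact: (H t' s' _ _).1.
have [s' [t' [sh' th' e2]]] := second_difference h0 H' sf.
have E : 'D_w ('D_v f) (x + s *: v + t *: w) = 'D_v ('D_w f) (x + s' *: w + t' *: v).
  move: e1 e2; set p := 'D_w _ _; set p' := 'D_v _ _; rewrite (addrAC x (h *: w)).
  set A := f (x + _ + _); set B := f (x + _); set C := f (x + _) => e1 e2.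
  have h20 : h ^+ 2 != 0 by rewrite expf_neq0 // gt_eqF.
  clearbody p p' A B C.
  by apply: (mulfI h20); rewrite -e1 -e2; ring.
have a2 := (H s t sh th).2.2; have a1 := (H t' s' th' sh').2.1.
rewrite /= addrAC -E in a1; rewrite /= in a2.
exact: (close_to_common a1 a2).
Qed.

Lemma close_sum (a b c b' c' e : R) : `|b - b'| < e / 3 -> `|c - c'| < e / 3 ->
  `|a - (b' + c')| < e / 3 -> `|a - (b + c)| <= e.
Proof.
rewrite !ltr_norml ler_norml => /andP[? ?] /andP[? ?] /andP[? ?].
by apply/andP; split; lra.
Qed.

(** Directional derivatives are additive in the direction once they are
    continuous: go from x to x + h (v + w) along the diagonal, or along v and
    then along w. *)
Lemma derive_dirD (U : set V) f x v w : open U -> U x -> smooth_open U f ->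
  'D_(v + w) f x = 'D_v f x + 'D_w f x.
Proof.
move=> oU Ux sf; apply/eqP; rewrite -subr_eq0 -normr_le0; apply/ler_addgt0Pl => e e0.
rewrite addr0.
have c1 := (sf [:: v] x Ux).1; have c2 := (sf [:: w] x Ux).1.
have c3 := (sf [:: v + w] x Ux).1.
have e30 : 0 < e / 3 by rewrite divr_gt0.
move/cvgrPdist_lt/(_ _ e30) : c1; move/cvgrPdist_lt/(_ _ e30) : c2.
move/cvgrPdist_lt/(_ _ e30) : c3 => /= n3 n2 n1.
have nU : nbhs x U by exact: open_nbhs_nbhs.
have [h h0 H] := nbhs_parallelogram v w (filterI (filterI nU n1) (filterI n2 n3)).
have i0 : 0 \in `[0, h] by rewrite in_itv /= lexx ltW.
have ih : h \in `[0, h] by rewrite in_itv /= lexx ltW.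
have [s sh e1] : exists2 s, s \in `]0, h[ & f (x + h *: v) - f x = h * 'D_v f (x + s *: v).
  apply: (line_mvt h0).
  move=> s sh; have := (H s 0 sh i0).1.1; rewrite scale0r addr0.
  by move=> /(sf [::])[_ /=]; apply.
have [t th e2] : exists2 t, t \in `]0, h[ &
    f (x + h *: v + h *: w) - f (x + h *: v) = h * 'D_w f (x + h *: v + t *: w).
  apply: (line_mvt h0).
  by move=> t th; have := (H h t ih th).1.1; move=> /(sf [::])[_ /=]; apply.
have [r rh e3] : exists2 r, r \in `]0, h[ &
    f (x + h *: (v + w)) - f x = h * 'D_(v + w) f (x + r *: (v + w)).
  apply: (line_mvt h0).
  move=> r rh; rewrite scalerDr addrA.
  by have := (H r r rh rh).1.1; move=> /(sf [::])[_ /=]; apply.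
have {}sh := subset_itv_oo_cc sh; have {}th := subset_itv_oo_cc th.
have {}rh := subset_itv_oo_cc rh.
have E : 'D_(v + w) f (x + r *: (v + w)) = 'D_v f (x + s *: v) + 'D_w f (x + h *: v + t *: w).
  have hn0 : h != 0 by rewrite gt_eqF.
  by apply: (mulfI hn0); rewrite -e3 mulrDr -e1 -e2 scalerDr addrA [RHS]addrC subrKA.
have a1 : `|'D_v f x - 'D_v f (x + s *: v)| < e / 3.
  by have := (H s 0 sh i0).1.2; rewrite scale0r addr0.
have a2 := (H h t ih th).2.1; have a3 := (H r r rh rh).2.2.
rewrite /= -addrA -scalerDr E in a3; rewrite /= in a2.
exact: (close_sum a1 a2 a3).
Qed.

Lemma derive_dirZ f x v (a : R) : derivable f x v -> 'D_(a *: v) f x = a * 'D_v f x.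
Proof.
have [->|a0] := eqVneq a 0; first by rewrite scale0r derive0 mul0r.
move=> d; have d0 : derivable f (x + 0 *: v) v by rewrite scale0r addr0.
have L : is_derive (0 : R) 1 (fun r : R => f (x + r *: v)) ('D_v f x).
  by have := is_derive_line d0; rewrite scale0r addr0.
have L' : is_derive (0 : R) 1 (fun r : R => f (x + (a * r) *: v)) (a * 'D_v f x).
  have i : is_derive (0 : R) (1 : R) (fun r : R => a * r) a.
    by have := is_deriveZ a (is_derive_id (0 : R) 1); rewrite [a *: 1]mulr1.
  have L0 : is_derive (a * 0) (1 : R) (fun r : R => f (x + r *: v)) ('D_v f x) by rewrite mulr0.
  have := @is_derive1_comp _ (fun r : R => f (x + r *: v)) (fun r : R => a * r) 0 _ _ L0 i.
  by rewrite mulrC.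
rewrite -(@derive_val _ _ _ _ _ _ _ L').
have E : (fun h : R => h^-1 *: ((f \o shift x) (h *: (a *: v)) - f x)) =
  (fun h : R => h^-1 *: (((fun r : R => f (x + (a * r) *: v)) \o shift 0) (h *: (1 : R))
     - f (x + (a * 0) *: v))).
  apply/funext => h /=.
  rewrite mulr0 scale0r !addr0 [h *: 1]mulr1 scalerA (mulrC a h).
  by rewrite [x + _]addrC.
by rewrite /derive E.
Qed.

End MeanValue.

(** * The ring of smooth functions on an open set *)

Section Smooth.
Context {R : realType} {V W : normedModType R}.
Implicit Types (U : set V) (f g : V -> W).

Definition regular U f : Prop :=
  forall x, U x -> {for x, continuous f} /\ forall v, derivable f x v.

(** Smoothness asks for all iterated derivatives at once.  Cutting at finite
    order k allows inductions in which a product or an inverse of order k + 1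
    is handled through the Leibniz rule at order k. *)
Fixpoint diff_class k U f : Prop :=
  regular U f /\
  if k is k'.+1 then forall v, diff_class k' U ('D_v f) else True.

Lemma diff_class_regular k U f : diff_class k U f -> regular U f.
Proof. by case: k => [|k] []. Qed.

Lemma smooth_openP U f : smooth_open U f <-> forall k, diff_class k U f.
Proof.
split=> [sf k|].
  elim: k f sf => [|k IH] f sf /=; split => //; try by move=> x Ux; exact: (sf [::] x Ux).
  by move=> v; apply: IH => vs x Ux; have := sf (rcons vs v) x Ux; rewrite /= foldr_rcons.
move=> cf vs; elim/last_ind: vs f cf => [|vs v IH] f cf x Ux.
  exact: (diff_class_regular (cf 0%N)).
by rewrite foldr_rcons; apply: IH => // k; have [_ /(_ v)] := cf k.+1.
Qed.

Lemma regular_ext U f g : open U -> {in U, f =1 g} -> regular U f -> regular U g.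
Proof.
move=> oU e rf x Ux; have nU : nbhs x U by exact: open_nbhs_nbhs.
have efg : {near x, f =1 g}.
  by apply: filterS nU => y Uy; apply: e; rewrite inE.
have [cf df] := rf x Ux; split=> [|v]; last exact: near_eq_derivable (df v).
move: cf; rewrite /prop_for /continuous_at (e x (mem_set Ux)); apply: cvg_trans.
by apply: near_eq_cvg; apply: filterS efg => y.
Qed.

Lemma derive_ext U f g v : open U -> {in U, f =1 g} -> {in U, 'D_v f =1 'D_v g}.
Proof.
move=> oU e x; rewrite inE => Ux; apply: near_eq_derive.
by apply: filterS (open_nbhs_nbhs (conj oU Ux)) => y Uy; apply: e; rewrite inE.
Qed.

Lemma diff_class_ext k U f g : open U -> {in U, f =1 g} ->
  diff_class k U f -> diff_class k U g.
Proof.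
move=> oU; elim: k f g => [|k IH] f g e [rf cf]; split=> //;
  try exact: regular_ext rf.
by move=> v; apply: IH (cf v); exact: derive_ext.
Qed.

Lemma smooth_open_ext U f g : open U -> {in U, f =1 g} ->
  smooth_open U f -> smooth_open U g.
Proof.
by move=> oU e /smooth_openP sf; apply/smooth_openP => k; exact: diff_class_ext (sf k).
Qed.

Lemma smooth_open_sub U U' f : U' `<=` U -> smooth_open U f -> smooth_open U' f.
Proof. by move=> s sf vs x /s; exact: sf. Qed.

(** Smoothness is local: near each point of an open set the function agrees
    with its smooth extension. *)
Lemma smooth_on_open U f : open U -> smooth_on U f -> smooth_open U f.
Proof.
move=> oU sf vs x Ux; have [U' [F [oU' U'x sF e]]] := sf x Ux.
have oI : open (U' `&` U) by exact: openI.
have : smooth_open (U' `&` U) f.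
  apply: (@smooth_open_ext _ F) => //.
    by move=> y yI; rewrite e.
  by apply: smooth_open_sub sF => y [].
by apply; split.
Qed.

Lemma smooth_derive U f v : smooth_open U f -> smooth_open U ('D_v f).
Proof.
by move=> sf vs x Ux; have := sf (rcons vs v) x Ux; rewrite /= foldr_rcons.
Qed.

Lemma smooth_regular U f : smooth_open U f -> regular U f.
Proof. by move=> sf x Ux; exact: (sf [::] x Ux). Qed.

Lemma regular_cst U (c : W) : regular U (cst c).
Proof. by move=> x _; split=> [|v]; [exact: cst_continuous|exact: derivable_cst]. Qed.

Lemma smooth_cst U (c : W) : open U -> smooth_open U (cst c).
Proof.
move=> oU; apply/smooth_openP => k; elim: k c => [|k IH] c; split => //; try exact: regular_cst.
move=> v; apply: (diff_class_ext oU _ (IH 0)) => x _.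
by rewrite derive_cst.
Qed.

End Smooth.

Section SmoothRing.
Context {R : realType} {V : normedModType R}.
Variable (U : set V).
Hypothesis oU : open U.
Implicit Types (f g : V -> R).

Lemma regularD f g : regular U f -> regular U g -> regular U (f + g).
Proof.
move=> rf rg x Ux; have [cf df] := rf x Ux; have [cg dg] := rg x Ux.
by split=> [|v]; [exact: continuousD|exact: derivableD].
Qed.

Lemma regularN f : regular U f -> regular U (- f).
Proof.
move=> rf x Ux; have [cf df] := rf x Ux.
by split=> [|v]; [exact: continuousN|exact: derivableN].
Qed.

Lemma regularM f g : regular U f -> regular U g -> regular U (f * g).
Proof.
move=> rf rg x Ux; have [cf df] := rf x Ux; have [cg dg] := rg x Ux.
by split=> [|v]; [exact: continuousM|exact: derivableM].
Qed.

Lemma diff_classD k f g : diff_class k U f -> diff_class k U g -> diff_class k U (f + g).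
Proof.
elim: k f g => [|k IH] f g [rf cf] [rg cg]; (split; first exact: regularD); first by [].
move=> v; apply: (diff_class_ext oU _ (IH _ _ (cf v) (cg v))) => x.
by rewrite inE => Ux; rewrite deriveD; [|exact: (rf x Ux).2|exact: (rg x Ux).2].
Qed.

Lemma diff_classN k f : diff_class k U f -> diff_class k U (- f).
Proof.
elim: k f => [|k IH] f [rf cf]; (split; first exact: regularN); first by [].
move=> v; apply: (diff_class_ext oU _ (IH _ (cf v))) => x.
by rewrite inE => Ux; rewrite deriveN; [|exact: (rf x Ux).2].
Qed.

Lemma diff_classW k f : diff_class k.+1 U f -> diff_class k U f.
Proof.
by elim: k f => [|k IH] f [rf cf]; split=> // v; apply: IH; exact: cf.
Qed.

Lemma diff_classM k f g : diff_class k U f -> diff_class k U g -> diff_class k U (f * g).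
Proof.
elim: k f g => [|k IH] f g cf' cg'; have [rf cf] := cf'; have [rg cg] := cg';
  (split; first exact: regularM); first by [].
move=> v.
have h := diff_classD (IH _ _ (diff_classW cf') (cg v)) (IH _ _ (diff_classW cg') (cf v)).
apply: (diff_class_ext oU _ h) => x.
by rewrite inE => Ux; rewrite deriveM; [|exact: (rf x Ux).2|exact: (rg x Ux).2].
Qed.

Lemma smoothD f g : smooth_open U f -> smooth_open U g -> smooth_open U (f + g).
Proof.
move=> /smooth_openP sf /smooth_openP sg; apply/smooth_openP => k.
exact: diff_classD.
Qed.

Lemma smoothN f : smooth_open U f -> smooth_open U (- f).
Proof. by move=> /smooth_openP sf; apply/smooth_openP => k; exact: diff_classN. Qed.

Lemma smoothM f g : smooth_open U f -> smooth_open U g -> smooth_open U (f * g).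
Proof.
move=> /smooth_openP sf /smooth_openP sg; apply/smooth_openP => k.
exact: diff_classM.
Qed.

Lemma smoothV f : (forall x, U x -> f x != 0) -> smooth_open U f ->
  smooth_open U (fun x => (f x)^-1).
Proof.
move=> f0 /smooth_openP sf; apply/smooth_openP; elim=> [|k IH].
  split=> // x Ux; have [cf df] := diff_class_regular (sf 0%N) Ux.
  by split=> [|v]; [apply: continuousV; rewrite ?f0|apply: derivableV; rewrite ?f0].
split; first exact: (diff_class_regular IH).
move=> v; have [rf cf] := sf k.+1.
have h := diff_classN (diff_classM (diff_classM IH IH) (cf v)).
apply: (diff_class_ext oU _ h) => x; rewrite inE => Ux.
rewrite deriveV; [|exact: f0|exact: (rf x Ux).2].
by rewrite scaleNr -exprVn expr2.
Qed.
End SmoothRing.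

Section SmoothFun.
Context {R : realType} {V : normedModType R} {U : set V}.

(** The value 0 outside the open set makes equality of elements equality on the
    open set.  Openness is a parameter because the derivatives are local only
    on open sets. *)
Record smooth_fun (oU : open U) := SmoothFun {
  sfun :> V -> R;
  sfun_smooth : smooth_open U sfun;
  sfun_out : forall x, ~ U x -> sfun x = 0 }.

Variable oU : open U.
Local Notation A := (smooth_fun oU).
Implicit Types a b : A.

HB.instance Definition _ := gen_eqMixin A.
HB.instance Definition _ := gen_choiceMixin A.

Lemma smooth_funP a b : (forall x, U x -> a x = b x) -> a = b.
Proof.
move=> e; have {}e : sfun a = sfun b.
  apply/funext => x; have [/e//|nUx] := pselect (U x).
  by rewrite !sfun_out.
case: a b e => f sf zf [g sg zg] /= e; case: _ / e sg zg => sg zg.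
by congr SmoothFun; exact: Prop_irrelevance.
Qed.

Lemma restrict_smooth (f : V -> R) : smooth_open U f ->
  {a : A | forall x, U x -> a x = f x}.
Proof.
move=> sf; pose f0 x := if `[< U x >] then f x else 0.
have f0E x : U x -> f0 x = f x by move=> Ux; rewrite /f0 asboolT.
have sf0 : smooth_open U f0.
  by apply: smooth_open_ext sf => // x; rewrite inE => Ux; rewrite f0E.
have out x : ~ U x -> f0 x = 0 by move=> Ux; rewrite /f0 asboolF.
by exists (SmoothFun oU sf0 out).
Qed.

Definition mk_smooth f (sf : smooth_open U f) : A := sval (restrict_smooth sf).

Lemma mk_smoothE f (sf : smooth_open U f) x : U x -> mk_smooth sf x = f x.
Proof. exact: (svalP (restrict_smooth sf)). Qed.

(** The operations are given by opaque witnesses and used only through their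
    values on U: comparing two elements of the ring then never unfolds them to
    the underlying functions. *)
Fact const_subproof c : {d : A | forall x, U x -> d x = c}.
Proof. exact: restrict_smooth (smooth_cst c oU). Qed.
Fact add_subproof a b : {d : A | forall x, U x -> d x = a x + b x}.
Proof. exact: restrict_smooth (smoothD oU (sfun_smooth a) (sfun_smooth b)). Qed.
Fact opp_subproof a : {d : A | forall x, U x -> d x = - a x}.
Proof. exact: restrict_smooth (smoothN oU (sfun_smooth a)). Qed.
Fact mul_subproof a b : {d : A | forall x, U x -> d x = a x * b x}.
Proof. exact: restrict_smooth (smoothM oU (sfun_smooth a) (sfun_smooth b)). Qed.
Fact derive_subproof v a : {d : A | forall x, U x -> d x = 'D_v a x}.
Proof. exact: restrict_smooth (smooth_derive v (sfun_smooth a)). Qed.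

Definition sf_const c : A := sval (const_subproof c).
Definition sf_add a b : A := sval (add_subproof a b).
Definition sf_opp a : A := sval (opp_subproof a).
Definition sf_mul a b : A := sval (mul_subproof a b).
Definition sf_derive v a : A := sval (derive_subproof v a).

Section Pointwise.
Variables (x : V) (Ux : U x).
Lemma sf_constE c : sf_const c x = c. Proof. exact: (svalP (const_subproof c)). Qed.
Lemma sf_addE a b : sf_add a b x = a x + b x. Proof. exact: (svalP (add_subproof a b)). Qed.
Lemma sf_oppE a : sf_opp a x = - a x. Proof. exact: (svalP (opp_subproof a)). Qed.
Lemma sf_mulE a b : sf_mul a b x = a x * b x. Proof. exact: (svalP (mul_subproof a b)). Qed.
Lemma sf_deriveE v a : sf_derive v a x = 'D_v a x. Proof. exact: (svalP (derive_subproof v a)). Qed.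
End Pointwise.

Fact sf_addA : associative sf_add.
Proof. by move=> a b c; apply: smooth_funP => x Ux; rewrite !sf_addE // addrA. Qed.
Fact sf_addC : commutative sf_add.
Proof. by move=> a b; apply: smooth_funP => x Ux; rewrite !sf_addE // addrC. Qed.
Fact sf_add0 : left_id (sf_const 0) sf_add.
Proof. by move=> a; apply: smooth_funP => x Ux; rewrite sf_addE // sf_constE // add0r. Qed.
Fact sf_addN : left_inverse (sf_const 0) sf_opp sf_add.
Proof.
by move=> a; apply: smooth_funP => x Ux; rewrite sf_addE // sf_oppE // sf_constE // addNr.
Qed.
HB.instance Definition _ := GRing.isZmodule.Build A sf_addA sf_addC sf_add0 sf_addN.

Fact sf_mulA : associative sf_mul.
Proof. by move=> a b c; apply: smooth_funP => x Ux; rewrite !sf_mulE // mulrA. Qed.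
Fact sf_mulC : commutative sf_mul.
Proof. by move=> a b; apply: smooth_funP => x Ux; rewrite !sf_mulE // mulrC. Qed.
Fact sf_mul1 : left_id (sf_const 1) sf_mul.
Proof. by move=> a; apply: smooth_funP => x Ux; rewrite sf_mulE // sf_constE // mul1r. Qed.
Fact sf_mulD : left_distributive sf_mul sf_add.
Proof.
move=> a b c; apply: smooth_funP => x Ux.
by rewrite (sf_addE Ux) !(sf_mulE Ux) sf_addE // mulrDl.
Qed.
HB.instance Definition _ := GRing.Zmodule_isComPzRing.Build A sf_mulA sf_mulC sf_mul1 sf_mulD.

Section Eval.
Variables (x : V) (Ux : U x).
(** Evaluation at a point of U is a morphism of rings; the point must lie in U
    because every element, 1 included, vanishes elsewhere. *)
Definition sf_eval of U x := fun a : A => a x.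

Fact sf_eval_additive : zmod_morphism (sf_eval Ux).
Proof. by move=> a b; rewrite /sf_eval [LHS](sf_addE Ux) [X in _ + X](sf_oppE Ux). Qed.
HB.instance Definition _ := GRing.isZmodMorphism.Build A R (sf_eval Ux) sf_eval_additive.
Fact sf_eval_monoid : monoid_morphism (sf_eval Ux).
Proof. by split=> [|a b]; [exact: (sf_constE Ux)|exact: (sf_mulE Ux)]. Qed.
HB.instance Definition _ := GRing.isMonoidMorphism.Build A R (sf_eval Ux) sf_eval_monoid.

Lemma sf_evalD a b : (a + b) x = a x + b x. Proof. exact: sf_addE. Qed.
Lemma sf_evalN a : (- a) x = - a x. Proof. exact: sf_oppE. Qed.
Lemma sf_evalB a b : (a - b) x = a x - b x. Proof. by rewrite sf_evalD sf_evalN. Qed.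
Lemma sf_evalM a b : (a * b) x = a x * b x. Proof. exact: sf_mulE. Qed.
Lemma sf_eval_nat m : (m%:R : A) x = m%:R.
Proof. exact: (rmorph_nat (sf_eval Ux)). Qed.
Lemma sf_eval_sum (J : Type) (r : seq J) (P : pred J) (F : J -> A) :
  (\sum_(i <- r | P i) F i) x = \sum_(i <- r | P i) F i x.
Proof. exact: (rmorph_sum (sf_eval Ux)). Qed.
End Eval.

Lemma sf_derivation v : derivation (sf_derive v).
Proof.
have dr (a : A) x : U x -> derivable a x v.
  by move=> Ux; exact: (smooth_regular (sfun_smooth a) Ux).2.
have ext (f : A) (h : V -> R) x : U x -> (forall y, U y -> f y = h y) ->
    'D_v f x = 'D_v h x.
  move=> Ux e; apply: (derive_ext _ oU _ (mem_set Ux)) => y; rewrite inE; exact: e.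
split=> a b; apply: smooth_funP => x Ux.
- rewrite (sf_deriveE Ux) (ext _ ((a : V -> R) + (b : V -> R)) x Ux); last by move=> y Uy; exact: (sf_addE Uy).
  by rewrite deriveD ?[RHS](sf_addE Ux) ?sf_deriveE //; exact: dr.
- rewrite (sf_deriveE Ux) (ext _ ((a : V -> R) * (b : V -> R)) x Ux); last by move=> y Uy; exact: (sf_mulE Uy).
  rewrite deriveM; [|exact: dr|exact: dr].
  rewrite [RHS](sf_addE Ux) [X in _ = X + _](sf_mulE Ux) [X in _ = _ + X](sf_mulE Ux).
  by rewrite !sf_deriveE // addrC [X in X + _]mulrC.
Qed.

Lemma sf_derive_comm v w a : sf_derive v (sf_derive w a) = sf_derive w (sf_derive v a).
Proof.
have ext u u' x : U x -> 'D_u (sf_derive u' a) x = 'D_u ('D_u' a) x.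
  move=> Ux; apply: (derive_ext _ oU _ (mem_set Ux)) => y; rewrite inE => Uy.
  exact: sf_deriveE.
apply: smooth_funP => x Ux.
transitivity ('D_v (sf_derive w a) x); first exact: (sf_deriveE Ux v (sf_derive w a)).
transitivity ('D_v ('D_w a) x); first exact: (ext v w x Ux).
transitivity ('D_w ('D_v a) x); first exact: (derive_commute v w oU Ux (sfun_smooth a)).
transitivity ('D_w (sf_derive v a) x); first by rewrite (ext w v x Ux).
by rewrite (sf_deriveE Ux w (sf_derive v a)).
Qed.

Lemma sf_derive_const v c : sf_derive v (sf_const c) = 0.
Proof.
apply: smooth_funP => x Ux; rewrite (sf_deriveE Ux) [RHS](sf_constE Ux).
rewrite -[RHS](derive_cst c x v); apply: (derive_ext _ oU _ (mem_set Ux)) => y.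
by rewrite inE => Uy; exact: (sf_constE Uy).
Qed.

Lemma sf_inv (a : A) : (forall x, U x -> a x != 0) ->
  {b : A | b * a = 1 & forall x, U x -> b x = (a x)^-1}.
Proof.
move=> a0; exists (mk_smooth (smoothV oU a0 (sfun_smooth a))).
  apply: smooth_funP => x Ux; rewrite [LHS](sf_mulE Ux) (mk_smoothE _ Ux).
  by rewrite mulVf ?a0 // [RHS](sf_constE Ux).
by move=> x Ux; exact: (mk_smoothE _ Ux).
Qed.

End SmoothFun.

Section SmoothMatrix.
Context {R : realType} {V : normedModType R} {m n : nat}.

Lemma smooth_entry (U : set V) (f : V -> 'M[R]_(m, n)) i j : open U ->
  smooth_open U f -> smooth_open U (fun x => f x i j).
Proof.
move=> oU /smooth_openP sf; apply/smooth_openP => k; move: (sf k).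
elim: k f {sf} => [|k IH] f [rf cf].
  split=> // x /rf [c d]; split=> [|v]; last by move/derivable_mxP: (d v).
  exact: (continuous_comp c (@coord_continuous _ _ _ i j _)).
split.
  move=> x /rf [c d]; split=> [|v]; last by move/derivable_mxP: (d v).
  exact: (continuous_comp c (@coord_continuous _ _ _ i j _)).
move=> v; apply: (diff_class_ext oU _ (IH _ (cf v))) => x; rewrite inE => Ux.
by rewrite derive_mx ?mxE //; exact: (rf x Ux).2.
Qed.
End SmoothMatrix.

(** A metric that does not depend on time is a constant family, which makes the
    facts about families available at a single time. *)
Lemma smooth_snd (R : realType) (V1 V2 W : normedModType R) (U : set V2) (f : V2 -> W) :
  open U -> smooth_open U f -> smooth_open (setT `*` U) (fun p : V1 * V2 => f p.2).
Proof.
move=> oU sf vs x [_ Ux].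
have -> : foldr (fun v k => 'D_v k) (fun p : V1 * V2 => f p.2) vs
   = fun p => foldr (fun v k => 'D_v k) f (map snd vs) p.2.
  elim: vs => //= v vs ->; apply/funext => p.
  by rewrite /derive.
have [c d] := sf (map snd vs) x.2 Ux; split; last by move=> v; exact: d.
by apply: continuous_comp; [exact: cvg_snd|exact: c].
Qed.

(** * Time-dependent metrics in a chart *)

(** A family of metrics [G] over a time interval [I] in a chart with image [C]
    gives elements of the ring of smooth functions on I x C.  Its local
    geometry is represented by the ring elements of the algebraic part: the
    lemmas [_rep] translate each notion. *)
Section Family.
Context {R : realType} {n : nat}.
Variables (I : set R) (C : set 'rV[R]_n) (G : R -> 'rV[R]_n -> 'M[R]_n).
Hypotheses (oI : open I) (oC : open C).
Local Notation V := (R * 'rV[R]_n)%type.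
Hypothesis smG : smooth_open (I `*` C) (fun p : V => G p.1 p.2).
Hypothesis symG : forall s x, I s -> C x -> (G s x)^T = G s x.
Hypothesis unitG : forall s x, I s -> C x -> G s x \in unitmx.

Fact open_box : open (I `*` C : set V).
Proof.
rewrite openE => -[s x] [/= Is Cx]; exists (I, C) => //=.
by split; exact: open_nbhs_nbhs.
Qed.

Local Notation A := (smooth_fun open_box).

Lemma family_ext (a b : A) :
  (forall s x, I s -> C x -> a (s, x) = b (s, x)) -> a = b.
Proof. by move=> e; apply: smooth_funP => -[s x] [/= Is Cx]; exact: e. Qed.

Definition dx i : A -> A := fun a => sf_derive ((0, delta_mx 0 i) : V) a.
Definition dt : A -> A := fun a => sf_derive ((1, 0) : V) a.
Definition represents (a : A) (F : R -> 'rV[R]_n -> R) :=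
  forall s x, I s -> C x -> a (s, x) = F s x.

Definition sf_half : A := sf_const open_box 2^-1.
Definition metricA i j : A := mk_smooth open_box (smooth_entry i j open_box smG).

Lemma half_half : sf_half + sf_half = 1.
Proof.
apply: smooth_funP => x Ux; rewrite [LHS](sf_addE Ux) [RHS](sf_constE open_box Ux).
by rewrite !(sf_constE open_box Ux) [RHS]splitr mul1r.
Qed.

Lemma metricA_rep i j : represents (metricA i j) (fun s x => G s x i j).
Proof. by move=> s x Is Cx; rewrite [LHS]mk_smoothE. Qed.

Let gM : 'M[A]_n := \matrix_(i, j) metricA i j.

Lemma box s x : I s -> C x -> (I `*` C) ((s, x) : V). Proof. by []. Qed.

Lemma ev_gM s x (Is : I s) (Cx : C x) :
  map_mx (@sf_eval _ _ _ open_box _ (box Is Cx)) gM = G s x.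
Proof. by apply/matrixP => i j; rewrite !mxE; exact: metricA_rep. Qed.

(** The inverse metric exists in the ring as the adjugate matrix divided by the
    determinant. *)
Lemma detA_unit p : (I `*` C) p -> (\det gM : A) p != 0.
Proof.
case: p => s x [/= Is Cx]; rewrite -[X in X != 0]/(@sf_eval _ _ _ open_box _ (box Is Cx) (\det gM)).
by rewrite -det_map_mx ev_gM -unitfE -unitmxE; exact: unitG.
Qed.

Definition cometricA i j : A := s2val (sf_inv detA_unit) * (\adj gM) i j.

Lemma metricA_sym i j : metricA i j = metricA j i.
Proof.
apply: family_ext => s x Is Cx; rewrite (metricA_rep i j Is Cx) (metricA_rep j i Is Cx).
by rewrite -[in LHS](symG Is Cx) mxE.
Qed.

Lemma metricA_cometricA i j : \sum_k metricA i k * cometricA k j = (i == j)%:R.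
Proof.
have : s2val (sf_inv detA_unit) *: (gM *m \adj gM) = 1%:M.
  rewrite mul_mx_adj scale_scalar_mx.
  by rewrite (s2valP (sf_inv detA_unit)).
move/matrixP/(_ i j); rewrite mxE [X in _ * X]mxE [RHS]mxE mulr_sumr => <-.
by apply: eq_bigr => k _; rewrite /cometricA [gM i k]mxE mulrCA.
Qed.

Lemma cometricA_rep i j : represents (cometricA i j) (fun s x => ginv (G s) x i j).
Proof.
move=> s x Is Cx.
have e : ((\adj gM) i j) (s, x) = (\adj (G s x)) i j.
  by rewrite -(ev_gM Is Cx) -map_mx_adj [RHS]mxE.
have d : (\det gM : A) (s, x) = \det (G s x) by rewrite -(ev_gM Is Cx) det_map_mx.
rewrite [LHS](sf_mulE (box Is Cx)) (s2valP' (sf_inv detA_unit) _ (box Is Cx)).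
by rewrite d e /ginv /invmx unitG // [RHS]mxE.
Qed.

Lemma cometricA_sym i j : cometricA i j = cometricA j i.
Proof.
apply: family_ext => s x Is Cx; rewrite (cometricA_rep i j Is Cx) (cometricA_rep j i Is Cx) /ginv.
by rewrite -[in LHS](symG Is Cx) -trmx_inv mxE.
Qed.

Lemma dxP i : derivation (dx i). Proof. exact: sf_derivation. Qed.
Lemma dtP : derivation dt. Proof. exact: sf_derivation. Qed.
Lemma dxC i j a : dx i (dx j a) = dx j (dx i a). Proof. exact: sf_derive_comm. Qed.
Lemma dtC i a : dt (dx i a) = dx i (dt a). Proof. exact: sf_derive_comm. Qed.

Lemma pderiv_rep a F i s x : represents a F -> I s -> C x ->
  dx i a (s, x) = pderiv i (F s) x.
Proof.
move=> aF Is Cx; rewrite (sf_deriveE (box Is Cx)) /pderiv.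
transitivity ('D_(delta_mx 0 i) (fun y => a (s, y)) x).
  rewrite /derive.
  have -> : (fun h : R => h^-1 *: ((a \o shift (s, x)) (h *: (0, delta_mx 0 i)) - a (s, x)))
    = (fun h : R => h^-1 *: (((fun y => a (s, y)) \o shift x) (h *: delta_mx 0 i) - a (s, x))).
    apply/funext => h /=; congr (_ *: (a _ - _)).
    by congr (_, _); rewrite /= scaler0 add0r.
  by [].
apply: near_eq_derive; apply: filterS (open_nbhs_nbhs (conj oC Cx)) => y Cy.
exact: aF.
Qed.

Lemma dx_rep a F i : represents a F -> represents (dx i a) (fun s => pderiv i (F s)).
Proof. by move=> aF s x Is Cx; exact: pderiv_rep. Qed.

Lemma dt_rep a F s x : represents a F -> I s -> C x ->
  is_derive s 1 (fun r => F r x) (dt a (s, x)).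
Proof.
move=> aF Is Cx.
have E : (fun h : R => h^-1 *: ((a \o shift (s, x)) (h *: (1, 0)) - a (s, x)))
    = (fun h : R => h^-1 *: (((fun r => a (r, x)) \o shift s) (h *: 1) - a (s, x))).
  apply/funext => h /=; congr (_ *: (a _ - _)).
  by congr (_, _); rewrite /= scaler0 add0r.
have d : is_derive s 1 (fun r => a (r, x)) (dt a (s, x)).
  split.
    rewrite /derivable -E.
    exact: (smooth_regular (sfun_smooth a) (box Is Cx)).2.
  by rewrite (sf_deriveE (box Is Cx)) /derive E.
apply: near_eq_is_derive d; apply: filterS (open_nbhs_nbhs (conj oI Is)) => r Ir.
exact: aF.
Qed.

Local Notation chrA := (chr dx sf_half metricA cometricA).
Local Notation riemA := (riem dx sf_half metricA cometricA).
Local Notation ricA := (ric dx sf_half metricA cometricA).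
Local Notation scalA := (scal dx sf_half metricA cometricA).
Local Notation covdA := (covd dx sf_half metricA cometricA).

Lemma chr_rep k i j : represents (chrA k i j) (fun s => christoffel (G s) k i j).
Proof.
move=> s x Is Cx; have b := box Is Cx.
rewrite /chr (sf_evalM b) (sf_eval_sum b) (sf_constE open_box b); congr (_ * _).
apply: eq_bigr => l _; rewrite (sf_evalM b) (sf_evalB b) (sf_evalD b).
congr (_ * (_ + _ - _)); first exact: cometricA_rep.
all: exact: (pderiv_rep _ (metricA_rep _ _)).
Qed.

Lemma riem_rep l i j k : represents (riemA l i j k) (fun s => riemann (G s) l i j k).
Proof.
move=> s x Is Cx; have b := box Is Cx.
rewrite /riem (sf_evalD b) (sf_evalB b) (sf_eval_sum b).
congr (_ - _ + _); [exact: (pderiv_rep i (chr_rep l j k))|exact: (pderiv_rep j (chr_rep l i k))|].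
apply: eq_bigr => p _; rewrite (sf_evalB b).
by congr (_ - _); rewrite (sf_evalM b); congr (_ * _); exact: chr_rep.
Qed.

Lemma ric_rep j k : represents (ricA j k) (fun s x => ricci (G s) x j k).
Proof.
move=> s x Is Cx; rewrite /ric (sf_eval_sum (box Is Cx)) mxE.
by apply: eq_bigr => i _; exact: riem_rep.
Qed.

Lemma scal_rep : represents scalA (fun s => scalar_curv (G s)).
Proof.
move=> s x Is Cx; have b := box Is Cx; rewrite /scal (sf_eval_sum b); apply: eq_bigr => i _.
rewrite (sf_eval_sum b); apply: eq_bigr => j _; rewrite (sf_evalM b).
by congr (_ * _); [exact: cometricA_rep|exact: ric_rep].
Qed.

Lemma covd_rep i j k :
  represents (covdA ricA i j k) (fun s => cov_deriv2 (G s) (ricci (G s)) i j k).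
Proof.
move=> s x Is Cx; have b := box Is Cx; rewrite /covd (sf_evalB b) (sf_eval_sum b).
congr (_ - _); first exact: (pderiv_rep i (ric_rep j k)).
apply: eq_bigr => p _; rewrite (sf_evalD b).
by congr (_ + _); rewrite (sf_evalM b); congr (_ * _); (exact: chr_rep || exact: ric_rep).
Qed.

Lemma gradient_rep a F k : represents a F ->
  represents (gradient dx cometricA a k) (fun s => grad (G s) (F s) k).
Proof.
move=> aF s x Is Cx; have b := box Is Cx; rewrite /gradient (sf_eval_sum b).
apply: eq_bigr => l _; rewrite (sf_evalM b).
by congr (_ * _); [exact: cometricA_rep|exact: pderiv_rep].
Qed.

Lemma lapl_rep a F : represents a F ->
  represents (lapl dx sf_half metricA cometricA a) (fun s => laplacian (G s) (F s)).
Proof.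
move=> aF s x Is Cx; have b := box Is Cx; rewrite /lapl (sf_eval_sum b); apply: eq_bigr => i _.
rewrite (sf_eval_sum b); apply: eq_bigr => j _.
rewrite (sf_evalM b) (sf_evalB b) (sf_eval_sum b); congr (_ * (_ - _)); first exact: cometricA_rep.
  exact: (pderiv_rep i (dx_rep j aF)).
apply: eq_bigr => k _; rewrite (sf_evalM b).
by congr (_ * _); [exact: chr_rep|exact: pderiv_rep].
Qed.

Lemma norm_rep : represents
  (\sum_i \sum_j \sum_k \sum_l cometricA i k * cometricA j l * ricA i j * ricA k l)
  (fun s => norm2_tensor2 (G s) (ricci (G s))).
Proof.
move=> s x Is Cx; have b := box Is Cx; rewrite (sf_eval_sum b); apply: eq_bigr => i _.
rewrite (sf_eval_sum b); apply: eq_bigr => j _.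
rewrite (sf_eval_sum b); apply: eq_bigr => k _; rewrite (sf_eval_sum b); apply: eq_bigr => l _.
rewrite (sf_evalM b); congr (_ * _); last exact: ric_rep.
rewrite (sf_evalM b); congr (_ * _); last exact: ric_rep.
by rewrite (sf_evalM b); congr (_ * _); exact: cometricA_rep.
Qed.

Section Flow.
Variables alpha beta : R.
Hypothesis flowG : forall s x, I s -> C x ->
  is_derive s 1 (fun r => G r x)
    (- (2 * alpha) *: ricci (G s) x - (beta * scalar_curv (G s) x) *: G s x).

Let al : A := sf_const open_box alpha.
Let be : A := sf_const open_box beta.

Lemma flowA i j : dt (metricA i j) = - (2%:R * al) * ricA i j - (be * scalA) * metricA i j.
Proof.
apply: family_ext => s x Is Cx.
have b := box Is Cx; have [fd fv] := flowG Is Cx.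
have := @derive_val _ _ _ _ _ _ _ (dt_rep (metricA_rep i j) Is Cx) => <-.
have := derive_mx fd; rewrite fv => /matrixP/(_ i j); rewrite [RHS]mxE => <-.
have lin (a c : R) (M N : 'M[R]_n) : (a *: M - c *: N) i j = a * M i j - c * N i j.
  by rewrite !mxE.
rewrite {}lin.
rewrite (sf_evalB b); congr (_ - _); rewrite (sf_evalM b); congr (_ * _).
- by rewrite (sf_evalN b) (sf_evalM b) (sf_eval_nat open_box b) (sf_constE open_box b).
- by rewrite (ric_rep i j Is Cx).
- by rewrite (sf_evalM b) (sf_constE open_box b) (scal_rep Is Cx).
- by rewrite (metricA_rep i j Is Cx).
Qed.

Let Dal i : dx i al = 0. Proof. exact: sf_derive_const. Qed.
Let Dbe i : dx i be = 0. Proof. exact: sf_derive_const. Qed.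

Lemma local_flow_christoffel s x k i j : I s -> C x ->
  is_derive s 1 (fun r => christoffel (G r) k i j x)
    (alpha * (\sum_l ginv (G s) x k l *
       (cov_deriv2 (G s) (ricci (G s)) l i j x
        - cov_deriv2 (G s) (ricci (G s)) i j l x
        - cov_deriv2 (G s) (ricci (G s)) j i l x))
     - beta / 2 *
       (pderiv i (scalar_curv (G s)) x * (k == j)%:R
        + pderiv j (scalar_curv (G s)) x * (k == i)%:R
        - grad (G s) (scalar_curv (G s)) k x * G s x i j)).
Proof.
move=> Is Cx; have := dt_rep (chr_rep k i j) Is Cx.
rewrite (flow_christoffel dxP half_half metricA_sym cometricA_sym metricA_cometricA dtP dtC Dal Dbe flowA).
set r := (r in is_derive _ _ _ r -> _); set r' := (r in _ -> is_derive _ _ _ r).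
suff -> : r = r' by [].
have b := box Is Cx; rewrite /r /r' {r r'}.
rewrite (sf_evalB b); congr (_ - _); rewrite (sf_evalM b); congr (_ * _).
- exact: (sf_constE open_box b).
- rewrite (sf_eval_sum b); apply: eq_bigr => l _; rewrite (sf_evalM b) (sf_evalB b); congr (_ * _).
    exact: cometricA_rep.
  by rewrite (sf_evalB b); congr (_ - _ - _); exact: covd_rep.
- by rewrite (sf_evalM b); congr (_ * _); exact: (sf_constE open_box b).
rewrite (sf_evalB b); congr (_ - _).
  rewrite (sf_evalD b); congr (_ + _); rewrite (sf_evalM b) (sf_eval_nat open_box b); congr (_ * _);
    exact: (pderiv_rep _ scal_rep).
by rewrite (sf_evalM b); congr (_ * _); [exact: (gradient_rep _ scal_rep)|exact: metricA_rep].
Qed.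

Lemma local_flow_scal s x : I s -> C x ->
  is_derive s 1 (fun r => scalar_curv (G r) x)
    ((alpha + (n%:R - 1) * beta) * laplacian (G s) (scalar_curv (G s)) x
     + 2 * alpha * norm2_tensor2 (G s) (ricci (G s)) x
     + beta * scalar_curv (G s) x ^+ 2).
Proof.
move=> Is Cx; have := dt_rep scal_rep Is Cx.
rewrite (flow_scal dxP dxC half_half metricA_sym cometricA_sym metricA_cometricA dtP dtC Dal Dbe flowA).
set r := (r in is_derive _ _ _ r -> _); set r' := (r in _ -> is_derive _ _ _ r).
suff -> : r = r' by [].
have b := box Is Cx; rewrite /r /r' {r r'}.
rewrite (sf_evalD b); congr (_ + _); last first.
  rewrite (sf_evalM b) (sf_constE open_box b) !expr2 (sf_evalM b); congr (_ * (_ * _)); exact: scal_rep.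
rewrite (sf_evalD b); congr (_ + _); rewrite (sf_evalM b); congr (_ * _).
- rewrite (sf_evalD b) (sf_constE open_box b) (sf_evalM b) (sf_evalB b) (sf_constE open_box b).
  by rewrite (sf_eval_nat open_box b n) (sf_constE open_box b beta).
- exact: (lapl_rep scal_rep).
- by rewrite (sf_evalM b) (sf_eval_nat open_box b) (sf_constE open_box b).
- exact: norm_rep.
Qed.

(** Jacobi's formula, where the cofactors are det g times the inverse metric,
    so that the trace of d_t g appears. *)
Lemma local_flow_det s x : I s -> C x ->
  is_derive s 1 (fun r => \det (G r x))
    (- (2 * alpha + n%:R * beta) * scalar_curv (G s) x * \det (G s x)).
Proof.
have drep : represents (\det gM) (fun s x => \det (G s x)).
  by move=> s' x' Is' Cx'; rewrite -(ev_gM Is' Cx') det_map_mx.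
move=> Is Cx; have := dt_rep drep Is Cx.
have -> : dt (\det gM) = - (2%:R * al + n%:R * be) * scalA * \det gM.
  rewrite (der_det dtP).
  rewrite -(trace_metric_flow metricA_sym cometricA_sym metricA_cometricA flowA) mulr_suml.
  apply: eq_bigr => i _; rewrite mulr_suml; apply: eq_bigr => j _.
  rewrite mxE /cometricA.
  have -> : cofactor gM i j = \det gM * cometricA i j.
    rewrite cometricA_sym /cometricA mulrA [\det gM * _]mulrC.
    by rewrite (s2valP (sf_inv detA_unit)) mul1r mxE.
  by rewrite /cometricA; ring.
set r := (r in is_derive _ _ _ r -> _); set r' := (r in _ -> is_derive _ _ _ r).
suff -> : r = r' by [].
have b := box Is Cx; rewrite /r /r' {r r'}.
rewrite (sf_evalM b) (drep _ _ Is Cx) (sf_evalM b) (scal_rep Is Cx); congr (_ * _ * _).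
rewrite (sf_evalN b) (sf_evalD b); congr (- (_ + _)); rewrite (sf_evalM b) (sf_eval_nat open_box b); congr (_ * _);
  exact: (sf_constE open_box b).
Qed.
End Flow.
End Family.

(** * The flow in a chart *)

Section PosDef.
Context {R : realType} {n : nat}.
Definition posdef (H : 'M[R]_n) := forall v : 'rV[R]_n, v != 0 -> 0 < (v *m H *m v^T) 0 0.

Lemma posdef_unit (H : 'M[R]_n) : posdef H -> H \in unitmx.
Proof.
move=> pH; rewrite unitmxE unitfE; apply/negP => /eqP /eqP/det0P [v v0 vH].
by have := pH v v0; rewrite vH mul0mx mxE ltxx.
Qed.

Lemma posdef_diag (H : 'M[R]_n) i : posdef H -> 0 < H i i.
Proof.
move=> pH; have v0 : delta_mx 0 i != 0 :> 'rV[R]_n.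
  apply/eqP => /matrixP/(_ 0 i); rewrite !mxE !eqxx => /eqP; by rewrite oner_eq0.
have := pH _ v0; rewrite -rowE mxE (bigD1 i) //= !mxE !eqxx mulr1 big1 ?addr0 // => k ki.
by rewrite !mxE (negbTE ki) andbF mulr0.
Qed.
End PosDef.

(** Evaluate the quadratic form at (g_01, -g_00): its value is g_00 det g. *)
Lemma posdef_det2 (R : realType) (H : 'M[R]_2) : H^T = H -> posdef H ->
  0 < H 0 0 * H 1 1 - H 0 1 ^+ 2.
Proof.
move=> sH pH; have H00 := posdef_diag 0 pH.
have H10 : H 1 0 = H 0 1 by rewrite -[in LHS]sH mxE.
pose v : 'rV[R]_2 := \row_i (if i == 0 then H 0 1 else - H 0 0).
have v0 : v != 0.
  apply/eqP => /matrixP/(_ 0 1); rewrite !mxE /= => /eqP.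
  by rewrite oppr_eq0 gt_eqF.
have := pH v v0; rewrite mxE sum_ord2 !mxE !sum_ord2 !mxE /= H10.
suff -> : (H 0 1 * H 0 0 + - H 0 0 * H 0 1) * H 0 1 + (H 0 1 * H 0 1 + - H 0 0 * H 1 1) * - H 0 0
  = H 0 0 * (H 0 0 * H 1 1 - H 0 1 ^+ 2) by rewrite pmulr_rgt0.
by ring.
Qed.

Section FamilySurface.
Context {R : realType}.
Variables (I : set R) (C : set 'rV[R]_2) (G : R -> 'rV[R]_2 -> 'M[R]_2).
Hypotheses (oI : open I) (oC : open C).
Hypothesis smG : smooth_open (I `*` C) (fun p : R * 'rV[R]_2 => G p.1 p.2).
Hypothesis symG : forall s x, I s -> C x -> (G s x)^T = G s x.
Hypothesis unitG : forall s x, I s -> C x -> G s x \in unitmx.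

Lemma family_surface_ric s x j k : I s -> C x ->
  (G s x 0 0 * G s x 1 1 - G s x 0 1 ^+ 2) * ricci (G s) x j k =
    (\sum_l G s x l 0 * riemann (G s) l 0 1 1 x) * G s x j k.
Proof.
move=> Is Cx.
have e := surface_ric (@dxP _ _ _ _ oI oC) (@dxC _ _ _ _ oI oC) (half_half oI oC)
  (metricA_sym oI oC smG symG) (cometricA_sym oI oC smG symG unitG) (metricA_cometricA oI oC smG unitG) j k.
have b : (I `*` C) (s, x) by [].
move: (congr1 (fun a : smooth_fun (open_box oI oC) => a (s, x)) e).
have -> : ((metricA oI oC smG 0 0 * metricA oI oC smG 1 1 - metricA oI oC smG 0 1 ^+ 2) *
     ric (dx (oC:=oC)) (sf_half oI oC) (metricA oI oC smG) (cometricA oI oC smG unitG) j k) (s, x)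
  = (G s x 0 0 * G s x 1 1 - G s x 0 1 ^+ 2) * ricci (G s) x j k.
  rewrite (sf_evalM b); congr (_ * _); last exact: ric_rep.
  rewrite (sf_evalB b) !expr2; congr (_ - _); rewrite (sf_evalM b); congr (_ * _); exact: metricA_rep.
move=> ->; rewrite (sf_evalM b); congr (_ * _); last exact: metricA_rep.
rewrite (sf_eval_sum b); apply: eq_bigr => l _; rewrite (sf_evalM b); congr (_ * _).
  exact: metricA_rep.
exact: riem_rep.
Qed.
End FamilySurface.

Section Surface.
Context {R : realType}.
Variables (C : set 'rV[R]_2) (H : 'rV[R]_2 -> 'M[R]_2).
Hypotheses (oC : open C) (sH : smooth_open C H).
Hypothesis symH : forall x, C x -> (H x)^T = H x.
Hypothesis posH : forall x, C x -> posdef (H x).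

Lemma surface_einstein x j k : C x -> ricci H x j k = gauss_curv H x * H x j k.
Proof.
move=> Cx.
have sm : smooth_open (setT `*` C) (fun p : R * 'rV[R]_2 => H p.2) by exact: smooth_snd.
have sym (s : R) y : setT s -> C y -> (H y)^T = H y by move=> _; exact: symH.
have un (s : R) y : setT s -> C y -> H y \in unitmx.
  by move=> _ Cy; exact/posdef_unit/posH.
have E := @family_surface_ric R setT C (fun=> H) openT oC sm sym un 0 x j k Logic.I Cx.
have d0 := posdef_det2 (symH Cx) (posH Cx).
apply: (mulfI (lt0r_neq0 d0)); rewrite E /gauss_curv.
by rewrite mulrA [_ * (_ / _)]mulrC divfK ?lt0r_neq0.
Qed.

Let Hsym x i j : C x -> H x i j = H x j i.
Proof. by move=> Cx; rewrite -[in LHS](symH Cx) mxE. Qed.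

Let qsym x i j : C x -> ginv H x i j = ginv H x j i.
Proof. by move=> Cx; rewrite /ginv -[in LHS](symH Cx) -trmx_inv mxE. Qed.

Let Hq x i j : C x -> \sum_k H x i k * ginv H x k j = (i == j)%:R.
Proof.
move=> Cx; have := mulmxV (posdef_unit (posH Cx)) => /matrixP/(_ i j).
by rewrite mxE [RHS]mxE.
Qed.

Lemma surface_scalar x : C x -> scalar_curv H x = 2 * gauss_curv H x.
Proof.
move=> Cx; apply: (@einstein_trace R 2 (H x) (ginv H x)) => *;
  [exact: Hsym|exact: qsym|exact: Hq|exact: surface_einstein].
Qed.

Lemma surface_norm x : C x -> norm2_tensor2 H (ricci H) x = 2 * gauss_curv H x ^+ 2.
Proof.
move=> Cx; apply: (@einstein_norm R 2 (H x) (ginv H x)) => *;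
  [exact: Hsym|exact: qsym|exact: Hq|exact: surface_einstein].
Qed.
End Surface.

Lemma derive_within_open (R : realType) (W : normedModType R) (I : set R)
    (f : R -> W) t l : open I -> I t ->
  has_derivative_within I f t l -> is_derive t 1 f l.
Proof.
move=> oI It fl.
have {}fl : (s - t)^-1 *: (f s - f t) @[s --> t^'] --> l.
  apply: cvg_trans fl; apply: cvg_app => A /= wA.
  have nI : nbhs t I by exact: open_nbhs_nbhs.
  have H1 : t^' [set s | I s -> A s] by exact: wA.
  have H2 : t^' I by apply: filterS nI => s Is _.
  have H3 : t^' ([set s | I s -> A s] `&` I) by exact: filterI.
  have H4 : t^' A by apply: filterS H3 => s [h Is]; exact: h.
  exact: H4.
have fl' : h^-1 *: ((f \o shift t) (h *: (1 : R)) - f t) @[h --> 0^'] --> l.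
  move/cvgrPdist_lt : fl => fl; apply/cvgrPdist_lt => e e0.
  have [d /= d0 dP] := fl e e0; exists d => // h /= hd h0.
  have := dP (h + t); rewrite addrK [h *: 1]mulr1; apply.
    by rewrite /ball /= opprD addrCA subrr addr0 -[- h]sub0r; exact: hd.
  by rewrite -subr_eq0 addrK.
by split; [apply/cvg_ex; exists l | exact: cvg_lim fl'].
Qed.

Lemma is_derive_continuous (R : realType) (f : R -> R) (t l : R) :
  is_derive t 1 f l -> {for t, continuous f}.
Proof.
by move=> [d _]; apply: differentiable_continuous; apply/derivable1_diffP.
Qed.

(** When f is negative near t both sides vanish, the square root of a negative
    number being 0. *)
Lemma is_derive_sqrt (R : realType) (f : R -> R) (t c : R) : f t != 0 ->
  is_derive t 1 f (2 * c * f t) ->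
  is_derive t 1 (fun s => Num.sqrt (f s)) (c * Num.sqrt (f t)).
Proof.
move=> f0 df; have cf := is_derive_continuous df.
have [fneg|fpos|e] := ltgtP (f t) 0; last by rewrite e eqxx in f0.
- rewrite (ltr0_sqrtr fneg) mulr0.
  have : is_derive t 1 (cst 0 : R -> R) 0 by exact: is_derive_cst.
  apply: near_eq_is_derive.
  have : \forall s \near t, f s < 0 by exact: (cvgr_lt (f t) cf).
  by apply: filterS => s sneg; rewrite ltr0_sqrtr.
- have ds := is_derive1_sqrt fpos.
  have := @is_derive1_comp _ Num.sqrt f t _ _ ds df.
  suff -> : (2 * Num.sqrt (f t))^-1 * (2 * c * f t) = c * Num.sqrt (f t) by [].
  have s0 : Num.sqrt (f t) != 0 by rewrite sqrtr_eq0 -ltNge.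
  have e := sqr_sqrtr (ltW fpos).
  by move: s0 e; move: (Num.sqrt (f t)) => S S0 <-; field.
Qed.

Section ChartFlow.
Context {R : realType} {n : nat} (M : smooth_manifold R n).
Variables (alpha beta : R) (I : set R) (g : R -> tensor2 M).
Hypothesis oI : open I.
Hypothesis flow : ricci_yamabe_flow alpha beta I g.
Variable c : chart_index M.
Let C := chart_cod (atlas c).
Let G := fun s => g s c.

Lemma chart_open : open C. Proof. exact: open_chart_cod. Qed.

Lemma flow_smooth : smooth_open (I `*` C) (fun p : R * 'rV[R]_n => G p.1 p.2).
Proof.
apply: smooth_on_open; first exact: open_box oI chart_open.
exact: flow.1.2.
Qed.

Lemma flow_sym s x : I s -> C x -> (G s x)^T = G s x.
Proof. by move=> Is Cx; have [_ + _ _] := flow.1.1 s Is; apply. Qed.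

Lemma flow_posdef s x : I s -> C x -> posdef (G s x).
Proof. by move=> Is Cx; have [_ _ + _] := flow.1.1 s Is; apply. Qed.

Lemma flow_unit s x : I s -> C x -> G s x \in unitmx.
Proof. by move=> Is Cx; exact/posdef_unit/flow_posdef. Qed.

Lemma flow_derive s x : I s -> C x -> is_derive s 1 (fun r => G r x)
    (- (2 * alpha) *: ricci (G s) x - (beta * scalar_curv (G s) x) *: G s x).
Proof. by move=> Is Cx; apply: derive_within_open (flow.2 s c x Is Cx). Qed.

Lemma flow_volume s x X : I s -> C x ->
  is_derive s 1 (fun r => volume_form (G r) x X)
    (- (alpha + n%:R / 2 * beta) * scalar_curv (G s) x * volume_form (G s) x X).
Proof.
move=> Is Cx.
have d := local_flow_det oI chart_open flow_smooth flow_sym flow_unit flow_derive Is Cx.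
have d0 : \det (G s x) != 0 by rewrite -unitfE -unitmxE flow_unit.
have e : - (2 * alpha + n%:R * beta) * scalar_curv (G s) x * \det (G s x)
  = 2 * (- (alpha + n%:R / 2 * beta) * scalar_curv (G s) x) * \det (G s x) by field.
rewrite e in d.
have := is_deriveZ (\det X) (is_derive_sqrt d0 d).
have -> : (\det X \*: (fun s0 : R => Num.sqrt (\det (G s0 x)))) = (fun r => volume_form (G r) x X).
  by apply/funext => r; rewrite /volume_form mulrC.
by rewrite /volume_form [_ *: _]mulrC mulrA.
Qed.
End ChartFlow.

Section SurfaceFlow.
Context {R : realType} (M : smooth_manifold R 2).
Variables (alpha beta : R) (I : set R) (g : R -> tensor2 M).
Hypothesis oI : open I.
Hypothesis flow : ricci_yamabe_flow alpha beta I g.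
Variable c : chart_index M.
Let C := chart_cod (atlas c).
Let G := fun s => g s c.

Let oC : open C := @chart_open R 2 M c.

Let smooth_slice s : I s -> smooth_open C (G s).
Proof.
by move=> Is; apply: smooth_on_open => //; have [+ _ _ _] := flow.1.1 s Is; apply.
Qed.

Lemma flow_einstein s x j k : I s -> C x ->
  ricci (G s) x j k = gauss_curv (G s) x * G s x j k.
Proof.
move=> Is; apply: (surface_einstein oC (smooth_slice Is)) => // y Cy;
  [exact: (flow_sym flow Is Cy)|exact: (flow_posdef flow Is Cy)].
Qed.

Lemma flow_scalar s x : I s -> C x -> scalar_curv (G s) x = 2 * gauss_curv (G s) x.
Proof.
move=> Is; apply: (surface_scalar oC (smooth_slice Is)) => // y Cy;
  [exact: (flow_sym flow Is Cy)|exact: (flow_posdef flow Is Cy)].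
Qed.

Lemma flow_norm s x : I s -> C x ->
  norm2_tensor2 (G s) (ricci (G s)) x = 2 * gauss_curv (G s) x ^+ 2.
Proof.
move=> Is; apply: (surface_norm oC (smooth_slice Is)) => // y Cy;
  [exact: (flow_sym flow Is Cy)|exact: (flow_posdef flow Is Cy)].
Qed.

Lemma flow_entry s x i j : I s -> C x ->
  is_derive s 1 (fun r => G r x i j)
    (- (2 * (alpha + beta)) * gauss_curv (G s) x * G s x i j).
Proof.
move=> Is Cx; have [d v] := flow_derive oI flow Is Cx.
split; first by move/derivable_mxP: d.
have := derive_mx d; rewrite v => /matrixP/(_ i j); rewrite [RHS]mxE => <-.
have lin (a b : R) (A B : 'M[R]_2) : (a *: A - b *: B) i j = a * A i j - b * B i j.
  by rewrite !mxE.
by rewrite lin flow_einstein // flow_scalar //; ring.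
Qed.

Let sm := flow_smooth oI flow (c := c).
Let sym := flow_sym flow (c := c).
Let unit := flow_unit flow (c := c).
Let K := sf_half oI oC * scal (dx (oC:=oC)) (sf_half oI oC) (metricA oI oC sm) (cometricA oI oC sm unit).

Lemma gauss_rep : represents K (fun s => gauss_curv (G s)).
Proof.
move=> s x Is Cx; have b : (I `*` C) (s, x) by [].
rewrite (sf_evalM b) (sf_constE _ b) (scal_rep oI oC sm unit Is Cx) flow_scalar //.
by rewrite mulrA mulVf ?mul1r.
Qed.

Lemma flow_scalar_derive s x : I s -> C x ->
  is_derive s 1 (fun r => scalar_curv (G r) x)
    ((alpha + beta) * (laplacian (G s) (scalar_curv (G s)) x + scalar_curv (G s) x ^+ 2)).
Proof.
move=> Is Cx; have := local_flow_scal oI oC sm sym unit (flow_derive oI flow (c := c)) Is Cx.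
set r := (r in is_derive _ _ _ r -> _); set r' := (r in _ -> is_derive _ _ _ r).
suff -> : r = r' by [].
by rewrite /r /r' -/(G s) flow_norm // flow_scalar //; ring.
Qed.

Lemma flow_gauss_derive s x : I s -> C x ->
  is_derive s 1 (fun r => gauss_curv (G r) x)
    ((alpha + beta) * (laplacian (G s) (gauss_curv (G s)) x + 2 * gauss_curv (G s) x ^+ 2)).
Proof.
move=> Is Cx; have b : (I `*` C) (s, x) by [].
have hc := sf_derive_const (open_box oI oC).
have dS : dt (scal (dx (oC:=oC)) (sf_half oI oC) (metricA oI oC sm) (cometricA oI oC sm unit)) (s, x)
   = (alpha + beta) * (laplacian (G s) (scalar_curv (G s)) x + scalar_curv (G s) x ^+ 2).
  have [_ <-] := dt_rep (scal_rep oI oC sm unit) Is Cx.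
  by have [_] := flow_scalar_derive Is Cx.
have dK : dt K (s, x) = 2^-1 * dt (scal (dx (oC:=oC)) (sf_half oI oC) (metricA oI oC sm) (cometricA oI oC sm unit)) (s, x).
  rewrite /K (derMc (@dtP _ _ _ _ oI oC)); last exact: hc.
  by rewrite (sf_evalM b); congr (_ * _); exact: (sf_constE _ b).
have lK : laplacian (G s) (gauss_curv (G s)) x = 2^-1 * laplacian (G s) (scalar_curv (G s)) x.
  rewrite -(lapl_rep sm unit gauss_rep Is Cx) /K lapl_scale; [|exact: dxP|move=> i; exact: hc].
  rewrite (sf_evalM b) (lapl_rep sm unit (scal_rep oI oC sm unit) Is Cx); congr (_ * _).
  exact: (sf_constE _ b).
have := dt_rep gauss_rep Is Cx; rewrite dK dS lK flow_scalar //.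
set r := (r in is_derive _ _ _ r -> _); set r' := (r in _ -> is_derive _ _ _ r).
by suff -> : r = r' by []; rewrite /r /r'; field.
Qed.
End SurfaceFlow.

(** * Minima and the Laplacian *)

(** The derivatives of a slice are derivatives of f in the directions (0, v). *)
Lemma smooth_slice (R : realType) (V1 V2 W : normedModType R) (U1 : set V1)
    (U2 : set V2) (f : V1 * V2 -> W) (s : V1) :
  U1 s -> smooth_open (U1 `*` U2) f -> smooth_open U2 (fun x => f (s, x)).
Proof.
move=> Us sf vs x Ux.
have -> : foldr (fun v k => 'D_v k) (fun x => f (s, x)) vs
   = fun x => foldr (fun v k => 'D_v k) f (map (pair 0) vs) (s, x).
  elim: vs => //= v vs ->; apply/funext => y; rewrite /derive.
  set h := foldr _ _ _.
  have -> // : (fun t : R => t^-1 *: (((fun x0 => h (s, x0)) \o shift y) (t *: v) - h (s, y)))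
     = (fun t : R => t^-1 *: ((h \o shift (s, y)) (t *: (0, v)) - h (s, y))).
  apply/funext => t /=; congr (_ *: (h _ - _)).
  by congr (_, _); rewrite /= scaler0 add0r.
set h := foldr _ _ _.
have [c d] := sf (map (pair 0) vs) (s, x) (conj Us Ux); split.
  apply: (@continuous_comp _ _ _ (fun y => (s, y)) h); last exact: c.
  by apply: cvg_pair => //=; exact: cvg_cst.
move=> v; have := d (0, v); rewrite /derivable.
have -> // : (fun t : R => t^-1 *: (((fun x0 => h (s, x0)) \o shift x) (t *: v) - h (s, x)))
     = (fun t : R => t^-1 *: ((h \o shift (s, x)) (t *: (0, v)) - h (s, x))).
apply/funext => t /=; congr (_ *: (h _ - _)).
by congr (_, _); rewrite /= scaler0 add0r.
Qed.

Section Minimum.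
Context {R : realType} {V : normedModType R}.
Variables (C : set V) (u : V -> R) (x : V).
Hypotheses (oC : open C) (Cx : C x) (su : smooth_open C u).
Hypothesis minu : \forall y \near x, u x <= u y.

Lemma min_first_derivative v : 'D_v u x = 0.
Proof.
have nC : nbhs x C by exact: open_nbhs_nbhs.
have [h h0 H] := nbhs_parallelogram v (- v) (filterI nC minu).
have H' r : r \in `]- h, h[ -> C (x + r *: v) /\ u x <= u (x + r *: v).
  rewrite in_itv /= => /andP[r1 r2]; have [r0|r0] := leP 0 r.
    have i1 : r \in `[0, h] by rewrite in_itv /= r0 ltW.
    have i0 : 0 \in `[0, h] by rewrite in_itv /= lexx ltW.
    by have := H r 0 i1 i0; rewrite scale0r addr0.
  have i1 : - r \in `[0, h] by rewrite in_itv /= oppr_ge0 (ltW r0) lerNl ltW.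
  have i0 : 0 \in `[0, h] by rewrite in_itv /= lexx ltW.
  by have := H 0 (- r) i0 i1; rewrite scale0r addr0 scalerN scaleNr opprK.
have dl r : r \in `]- h, h[ -> is_derive r 1 (fun r => u (x + r *: v)) ('D_v u (x + r *: v)).
  by move=> /H'[Cr _]; apply: is_derive_line; exact: (smooth_regular su Cr).2.
have i0 : 0 \in `]- h, h[ by rewrite in_itv /= oppr_lt0 h0.
have hh : - h <= h by rewrite ltW // (lt_trans _ h0) // oppr_lt0.
have m r : r \in `]- h, h[ -> u (x + 0 *: v) <= u (x + r *: v).
  by move=> /H'[_]; rewrite scale0r addr0.
have := derive1_at_min hh (fun r rh => @ex_derive _ _ _ _ _ _ _ (dl r rh)) i0 m.
by move=> [_]; have [_ ->] := dl 0 i0; rewrite scale0r addr0.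
Qed.

(** If the second derivative along v were negative it would be so near x; then
    D_v u, which vanishes at x, is negative just after x, and u decreases. *)
Lemma min_second_derivative v : 0 <= 'D_v ('D_v u) x.
Proof.
rewrite leNgt; apply/negP => neg.
have c2 := (su [:: v; v] Cx).1; rewrite /= in c2.
have n2 : \forall y \near x, 'D_v ('D_v u) y < 0.
  exact: (cvgr_lt ('D_v ('D_v u) x) c2).
have nC : nbhs x C by exact: open_nbhs_nbhs.
(* with w = 0 the parallelogram degenerates to a segment along v *)
have [h h0 H] := nbhs_parallelogram v 0 (filterI nC (filterI minu n2)).
have H' r : r \in `[0, h] -> [/\ C (x + r *: v), u x <= u (x + r *: v) &
     'D_v ('D_v u) (x + r *: v) < 0].
  by move=> rh; have := H r r rh rh; rewrite scaler0 addr0 => -[? []].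
have [r rh e1] : exists2 r, r \in `]0, h[ & u (x + h *: v) - u x = h * 'D_v u (x + r *: v).
  by apply: (line_mvt h0) => r /H'[Cr _ _]; exact: (smooth_regular su Cr).2.
have r0 : 0 < r by move: rh; rewrite in_itv /= => /andP[].
have rh' : r <= h by move: rh; rewrite in_itv /= => /andP[_ /ltW].
have sub z : z \in `[0, r] -> z \in `[0, h].
  by rewrite !in_itv /= => /andP[-> /le_trans]; apply.
have [z zr e2] : exists2 z, z \in `]0, r[ &
    'D_v u (x + r *: v) - 'D_v u x = r * 'D_v ('D_v u) (x + z *: v).
  apply: (@line_mvt _ _ ('D_v u) x v r r0) => z /sub/H'[Cz _ _].
  exact: (smooth_regular (smooth_derive v su) Cz).2.
have [_ _ neg'] := H' z (sub z (subset_itv_oo_cc zr)).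
have [_ pos _] : [/\ C (x + h *: v), u x <= u (x + h *: v) &
     'D_v ('D_v u) (x + h *: v) < 0].
  by apply: H'; rewrite in_itv /= lexx ltW.
move: e2; rewrite min_first_derivative subr0 => e2.
have : u (x + h *: v) - u x < 0 by rewrite e1 e2 pmulr_rlt0 // pmulr_rlt0.
by rewrite subr_lt0 ltNge pos.
Qed.
End Minimum.

Section LaplacianMinimum.
Context {R : realType}.
Variables (C : set 'rV[R]_2) (H : 'rV[R]_2 -> 'M[R]_2) (u : 'rV[R]_2 -> R) (x : 'rV[R]_2).
Hypotheses (oC : open C) (Cx : C x) (su : smooth_open C u).
Hypotheses (symH : (H x)^T = H x) (posH : posdef (H x)).
Hypothesis minu : \forall y \near x, u x <= u y.

(** At a critical point the Laplacian is the trace of the matrix of second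
    derivatives d with the inverse metric.  Writing the inverse metric by
    cofactors,
      g_00 det g (g^ij d_ij) = D_w D_w u + det g d_00  with w = (g_01, -g_00),
    and both terms are nonnegative. *)
Lemma laplacian_min : 0 <= laplacian H u x.
Proof.
pose e i : 'rV[R]_2 := delta_mx 0 i.
pose d i j := 'D_(e i) ('D_(e j) u) x.
have dC : d 0 1 = d 1 0 by exact: (derive_commute _ _ oC Cx su).
have LE : laplacian H u x = \sum_i \sum_j ginv H x i j * d i j.
  apply: eq_bigr => i _; apply: eq_bigr => j _; congr (_ * _); rewrite /hessian.
  have -> : \sum_k christoffel H k i j x * pderiv k u x = 0.
    apply: big1 => k _; have -> : pderiv k u x = 0 by exact: (min_first_derivative oC Cx su minu).
    exact: mulr0.
  exact: subr0.
have qq : forall i j, ginv H x i j = ginv H x j i.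
  by move=> i j; rewrite /ginv -[in LHS]symH -trmx_inv mxE.
have hh : forall i j, H x i j = H x j i by move=> i j; rewrite -[in LHS]symH mxE.
have hq : forall i j, \sum_k H x i k * ginv H x k j = (i == j)%:R.
  move=> i j; have := mulmxV (posdef_unit posH) => /matrixP/(_ i j).
  by rewrite mxE [RHS]mxE.
have [q00 q01 q11] := cometric2 hh qq hq.
have H00 := posdef_diag 0 posH; have det0 := posdef_det2 symH posH.
set D := H x 0 0 * H x 1 1 - H x 0 1 ^+ 2 in q00 q01 q11 det0.
pose a : R := H x 0 1; pose b : R := - H x 0 0; pose w := a *: e 0 + b *: e 1.
have dw (f : 'rV[R]_2 -> R) y : smooth_open C f -> C y ->
    'D_w f y = a * 'D_(e 0) f y + b * 'D_(e 1) f y.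
  move=> sf Cy; have df := (smooth_regular sf Cy).2.
  rewrite /w (derive_dirD _ _ oC Cy sf).
  by congr (_ + _); exact: derive_dirZ.
have dww : 'D_w ('D_w u) x = a ^+ 2 * d 0 0 + 2 * a * b * d 0 1 + b ^+ 2 * d 1 1.
  rewrite (dw _ _ (smooth_derive w su) Cx).
  have ext i : 'D_(e i) ('D_w u) x = a * d i 0 + b * d i 1.
    have E : {in C, 'D_w u =1 a \*: 'D_(e 0) u + b \*: 'D_(e 1) u}.
      by move=> y; rewrite inE => Cy; exact: dw.
    rewrite (derive_ext (e i) oC E (mem_set Cx)).
    have di j : derivable ('D_(e j) u) x (e i).
      exact: (smooth_regular (smooth_derive (e j) su) Cx).2.
    have dz (k : R) j : derivable (k \*: 'D_(e j) u) x (e i) by exact: derivableZ (di j).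
    rewrite (deriveD (dz a 0) (dz b 1)).
    by congr (_ + _); exact: deriveZ.
  have e0 := ext 0; have e1 := ext 1; rewrite e0 e1; clear -dC; rewrite -dC.
  by clearbody d; ring.
have p1 := min_second_derivative oC Cx su minu w; rewrite dww in p1.
have p2 := min_second_derivative oC Cx su minu (e 0); rewrite -/(d 0 0) in p2.
rewrite LE; clear dww dw LE minu su; clearbody d.
rewrite !sum_ord2 (qq 1 0) -dC.
have E : H x 0 0 * (D * (ginv H x 0 0 * d 0 0 + ginv H x 0 1 * d 0 1 +
   (ginv H x 0 1 * d 0 1 + ginv H x 1 1 * d 1 1))) =
   (a ^+ 2 * d 0 0 + 2 * a * b * d 0 1 + b ^+ 2 * d 1 1) + D * d 0 0.
  transitivity (H x 0 0 * ((D * ginv H x 0 0) * d 0 0 + 2 * (D * ginv H x 0 1) * d 0 1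
     + (D * ginv H x 1 1) * d 1 1)); first by ring.
  by rewrite q00 q01 q11 /D /a /b; ring.
rewrite -(pmulr_rge0 _ det0) -(pmulr_rge0 _ H00) E addr_ge0 // mulr_ge0 // ltW //.
Qed.
End LaplacianMinimum.

(** Only times before t are compared: the minimum may be attained at the end of
    the time interval. *)
Lemma left_min_derivative (R : realType) (f : R -> R) (t l e : R) : 0 < e ->
  is_derive t 1 f l -> (forall s, t - e < s < t -> f t <= f s) -> l <= 0.
Proof.
move=> e0 [df <-] m; rewrite leNgt; apply/negP => pos.
have /cvgrPdist_lt/(_ _ pos)[d /= d0 dP] : h^-1 *: ((f \o shift t) (h *: (1 : R)) - f t)
    @[h --> 0^'] --> 'D_1 f t by exact: df.
(* a negative increment at which the quotient is close to its limit *)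
pose h := - (Num.min d e / 2).
have m0 : 0 < Num.min d e by rewrite lt_min d0.
have h0 : h < 0 by rewrite oppr_lt0 divr_gt0.
have hmin : Num.min d e / 2 < Num.min d e by rewrite ltr_pdivrMr // ltr_pMr // ltr1n.
have hd : `|0 - h| < d.
  rewrite sub0r opprK ger0_norm ?ltW ?divr_gt0 //.
  by apply: lt_le_trans hmin _; rewrite ge_min lexx.
have := dP h hd; rewrite lt_eqF // => /(_ isT).
have q0 : h^-1 *: ((f \o shift t) (h *: (1 : R)) - f t) <= 0.
  rewrite /= [h *: 1]mulr1 [_ *: _]mulrC; apply: mulr_ge0_le0; last by rewrite invr_le0 ltW.
  rewrite subr_ge0; apply: m; rewrite gtrDr h0 andbT addrC ltrD2r /h ltrN2.
  by apply: lt_le_trans hmin _; rewrite ge_min lexx orbT.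
set q := _ *: _ in q0 *; rewrite ger0_norm; last by rewrite subr_ge0 (le_trans q0) ?ltW.
by rewrite gtrBl ltNge q0.
Qed.

(** * The lower bound for the Gaussian curvature *)

Lemma flow_restrict (R : realType) n (M : smooth_manifold R n) (alpha beta : R)
    (I I' : set R) (g : R -> tensor2 M) : I' `<=` I ->
  ricci_yamabe_flow alpha beta I g -> ricci_yamabe_flow alpha beta I' g.
Proof.
move=> sub [[mg sg] dg]; split; first split.
- by move=> t /sub; exact: mg.
- move=> c p [Ip Cp]; have [U [F [oU Up sF e]]] := sg c p (conj (sub _ Ip) Cp).
  exists U, F; split=> // q; rewrite inE => -[Uq [Iq Cq]].
  by apply: e; rewrite inE; split=> //; split=> //; exact: sub.
- move=> t c x It Cx; apply: cvg_trans (dg t c x (sub _ It) Cx).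
  apply: cvg_app => A /= wA.
  have H1 : t^' [set s | I s -> A s] by exact: wA.
  have H2 : t^' [set s | I' s -> A s] by apply: filterS H1 => s h /sub.
  exact: H2.
Qed.

Section Surface.
Context {R : realType} (M : smooth_manifold R 2).
Variables (alpha beta : R) (I : set R) (g : R -> tensor2 M).
Hypothesis oI : open I.
Hypothesis flow : ricci_yamabe_flow alpha beta I g.
Hypothesis apos : 0 < alpha + beta.
Local Notation a := (alpha + beta).
Local Notation K s c := (gauss_curv (g s c)).
Local Notation phi c := (chart_map (atlas c)).

(** Both components g_00 of the metric in c and the combination [F] of
    components in d that equals it satisfy d_t = -2 a K times themselves, with
    the K of the respective chart, because the Jacobian matrix [J] does not
    depend on time.  Compare the two derivatives. *)
Lemma gauss_chart_indep s c d (p : M) : I s ->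
  chart_dom (atlas c) p -> chart_dom (atlas d) p ->
  K s c (phi c p) = K s d (phi d p).
Proof.
move=> Is cp dp; set x := phi c p; set y := phi d p.
have Cx : chart_cod (atlas c) x by exact: chart_map_cod.
have Dy : chart_cod (atlas d) y by exact: chart_map_cod.
have xp : chart_inv (atlas c) x = p by rewrite /x chart_mapK ?inE.
have yE : transition (atlas c) (atlas d) x = y by rewrite /transition xp.
have ov : overlap (atlas c) (atlas d) x by split => //=; rewrite /preimage /= xp.
set J := 'J (transition (atlas c) (atlas d)) x.
have tr r : I r -> g r c x = J *m g r d y *m J^T.
  by move=> Ir; have [_ _ _ /(_ c d x ov)] := flow.1.1 r Ir; rewrite /= yE.
clearbody J; pose h i j := fun r => g r d y i j.
pose F : R -> R := (J 0 0 * J 0 0) \*: h 0 0 + (J 0 0 * J 0 1) \*: h 0 1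
   + (J 0 1 * J 0 0) \*: h 1 0 + (J 0 1 * J 0 1) \*: h 1 1.
have FE r : I r -> g r c x 0 0 = F r.
  move=> Ir; rewrite tr // mxE sum_ord2 !mxE !sum_ord2 /F /h.
  rewrite -![((_ + _) : R -> R) r]/(_ r + _ r) /=.
  rewrite /GRing.scale /=; ring.
have dh i j := flow_entry oI flow i j Is Dy.
have dF := is_deriveD (is_deriveD (is_deriveD (is_deriveZ (J 0 0 * J 0 0) (dh 0 0))
   (is_deriveZ (J 0 0 * J 0 1) (dh 0 1))) (is_deriveZ (J 0 1 * J 0 0) (dh 1 0)))
   (is_deriveZ (J 0 1 * J 0 1) (dh 1 1)).
have dc : is_derive s 1 F (- (2 * a) * K s c x * g s c x 0 0).
  apply: near_eq_is_derive (flow_entry oI flow 0 0 Is Cx).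
  by apply: filterS (open_nbhs_nbhs (conj oI Is)) => r Ir; exact: FE.
have [_ e1] := dc; have [_] := dF; rewrite -/F e1 => e2.
have g0 : 0 < g s c x 0 0 by exact: posdef_diag (flow_posdef flow Is Cx).
have k0 : - (2 * a) * g s c x 0 0 != 0.
  by rewrite mulf_neq0 ?oppr_eq0 ?mulf_neq0 // gt_eqF.
apply: (mulfI k0); rewrite -mulrA [_ * K s c x]mulrC mulrA e2.
rewrite FE // /F /h -![((_ + _) : R -> R) s]/(_ s + _ s) /= /GRing.scale /=; ring.
Qed.

Definition some_chart (p : M) : chart_index M := sval (cid (atlas_cover p)).

Lemma some_chartP p : chart_dom (atlas (some_chart p)) p.
Proof. exact: (svalP (cid (atlas_cover p))). Qed.

(** The Gaussian curvature as a function on the manifold; the choice of the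
    chart is immaterial by gauss_chart_indep. *)
Definition kappa s (p : M) := K s (some_chart p) (phi (some_chart p) p).

Lemma kappa_chart s c p : I s -> chart_dom (atlas c) p -> kappa s p = K s c (phi c p).
Proof. by move=> Is cp; apply: gauss_chart_indep => //; exact: some_chartP. Qed.

(** Near p the chosen chart of p can be used for all points. *)
Lemma kappa_continuous s p : I s ->
  {for (s, p), continuous (fun q : R * M => kappa q.1 q.2)}.
Proof.
move=> Is; have cp := some_chartP p; set c := some_chart p in cp.
have oD := @open_chart_dom R 2 M (atlas c).
have cphi : {for p, continuous (phi c)}.
  have := @chart_map_continuous R 2 M (atlas c).
  by rewrite continuous_open_subspace //; apply; rewrite inE.
have Cx : chart_cod (atlas c) (phi c p) by exact: chart_map_cod.
have rep := gauss_rep oI flow (c := c).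
set k := (k in represents k _) in rep.
have ck := (smooth_regular (sfun_smooth k) (box Is Cx)).1.
have cc : {for (s, p), continuous (fun q : R * M => k (q.1, phi c q.2))}.
  apply: (@continuous_comp _ _ _ (fun q : R * M => (q.1, phi c q.2)) k); last exact: ck.
  have h1 : {for (s, p), continuous (fst : R * M -> R)} by exact: cvg_fst.
  have h2 : {for (s, p), continuous (phi c \o (snd : R * M -> M))}.
    by apply: continuous_comp; [exact: cvg_snd|exact: cphi].
  exact: (cvg_pair h1 h2).
have near_k : \forall q \near (s, p), k (q.1, phi c q.2) = kappa q.1 q.2.
  exists (I, chart_dom (atlas c)).
    by split; exact: open_nbhs_nbhs.
  move=> [r z] [/= Ir cz]; rewrite (kappa_chart Ir cz).
  exact: (rep r (phi c z) Ir (chart_map_cod cz)).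
move: cc; rewrite /prop_for /continuous_at (nbhs_singleton near_k); apply: cvg_trans.
exact: near_eq_cvg.
Qed.

(** The weight s - e vanishes at the initial time e, so that the minimum, if it
    is too negative, is attained at a later time; there the equation
    d_t K = a (Delta K + 2 K^2) and the sign of Delta K contradict the
    minimality in time. *)
Lemma weighted_gauss_bound e t0 : closed_manifold M -> `[e, t0] `<=` I ->
  forall s p, s \in `[e, t0] -> - (2 * a)^-1 <= (s - e) * kappa s p.
Proof.
move=> cM sub s p st.
pose A : set (R * M) := `[e, t0] `*` setT.
pose u (q : R * M) := (q.1 - e) * kappa q.1 q.2.
have cA : compact A by apply: compact_setX => //; exact: segment_compact.
have A0 : A !=set0 by exists (s, p); split.
have cu : {within A, continuous u}.
  apply: continuous_in_subspaceT => -[r z]; rewrite inE => -[/= rt _].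
  have h1 : {for (r, z), continuous (fst : R * M -> R)} by exact: cvg_fst.
  have h2 : {for (r, z), continuous (fun=> e : R)} by exact: cvg_cst.
  have h3 := @kappa_continuous r z (sub _ rt).
  rewrite /prop_for /continuous_at /u; apply: cvgM; last exact: h3.
  by apply: cvgB; [exact: h1|exact: h2].
have [[s1 p1]] := compact_EVT_min A0 cA cu.
rewrite inE => -[/= st1 _] min1.
have min s' p' : s' \in `[e, t0] -> (s1 - e) * kappa s1 p1 <= (s' - e) * kappa s' p'.
  by move=> s't; apply: (min1 (s', p')); rewrite inE; split.
apply: (le_trans _ (min s p st)); rewrite leNgt; apply/negP => neg.
have Is1 : I s1 by exact: sub.
have es1 : e < s1.
  have : e <= s1 by move: st1; rewrite /= in_itv /= => /andP[].
  rewrite le_eqVlt => /orP[/eqP e1|//]; move: neg.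
  by rewrite -e1 subrr mul0r ltNge oppr_le0 invr_ge0 mulr_ge0 ?ltW.
have w0 : 0 < s1 - e by rewrite subr_gt0.
have cp := some_chartP p1; set c := some_chart p1 in cp.
set x := phi c p1; have Cx : chart_cod (atlas c) x by exact: chart_map_cod.
have kE : kappa s1 p1 = K s1 c x by exact: kappa_chart.
have oC := @chart_open R 2 M c.
have rep := gauss_rep oI flow (c := c); set k := (k in represents k _) in rep.
have sK : smooth_open (chart_cod (atlas c)) (K s1 c).
  apply: (@smooth_open_ext _ _ _ _ (fun y => k (s1, y))) => //.
    by move=> y; rewrite inE => Cy; exact: (rep s1 y Is1 Cy).
  exact: smooth_slice Is1 (sfun_smooth k).
have minK : \forall y \near x, K s1 c x <= K s1 c y.
  apply: filterS (open_nbhs_nbhs (conj oC Cx)) => y Cy.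
  have cy := chart_inv_dom Cy.
  have := min s1 (chart_inv (atlas c) y) st1.
  by rewrite (kappa_chart Is1 cy) kE chart_invK ?inE // ler_pM2l.
have L0 := laplacian_min oC Cx sK (flow_sym flow Is1 Cx) (flow_posdef flow Is1 Cx) minK.
have dK := flow_gauss_derive oI flow Is1 Cx; rewrite kE in neg min.
set L := laplacian _ _ _ in L0 dK; set k1 := gauss_curv _ _ in neg min dK.
have df : is_derive s1 1 (fun r => (r - e) * K r c x)
    (k1 + (s1 - e) * (a * (L + 2 * k1 ^+ 2))).
  have d1 : is_derive s1 1 (fun r : R => r - e) 1.
    have := is_deriveB (is_derive_id s1 1) (is_derive_cst e s1 1).
    by rewrite subr0.
  have := is_deriveM d1 dK.
  set l := (l in is_derive _ _ _ l -> _); set l' := (l in _ -> is_derive _ _ _ l).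
  suff -> : l = l' by [].
  by rewrite /l /l' /GRing.scale /= -/k1; ring.
have fle r : s1 - (s1 - e) < r < s1 -> (s1 - e) * k1 <= (r - e) * K r c x.
  rewrite opprB addrC subrK => /andP[er rs].
  have rt : r \in `[e, t0].
    rewrite in_itv /= (ltW er); apply: le_trans (ltW rs) _.
    by move: st1; rewrite /= in_itv /= => /andP[].
  by rewrite -(kappa_chart (sub _ rt) cp); exact: min.
have fneg := left_min_derivative w0 df fle.
have wk : 2 * a * ((s1 - e) * k1) < -1.
  have a2 : 0 < 2 * a by rewrite mulr_gt0.
  by move: neg; rewrite -(ltr_pM2l a2) mulrN divff ?gt_eqF.
have kneg : k1 < 0.
  rewrite -(pmulr_rlt0 _ w0); apply: lt_trans neg _.
  by rewrite oppr_lt0 invr_gt0 mulr_gt0.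
have : 0 < k1 * (1 + 2 * a * ((s1 - e) * k1)).
  by rewrite nmulr_lgt0 //; rewrite -ltrBrDl sub0r.
have : 0 <= (s1 - e) * (a * L) by rewrite !mulr_ge0 // ltW.
clear -fneg; clearbody k1 L => h1 h2; move: fneg; rewrite leNgt => /negP; apply.
have -> : k1 + (s1 - e) * (a * (L + 2 * k1 ^+ 2))
  = (s1 - e) * (a * L) + k1 * (1 + 2 * a * ((s1 - e) * k1)) by ring.
exact: ltr_wpDl.
Qed.

(** The bound with weight s - e, for e tending to 0. *)
Lemma gauss_bound_interior s p : closed_manifold M -> 0 < s -> `]0, s] `<=` I ->
  - (2 * a * s)^-1 <= kappa s p.
Proof.
move=> cM s0 sub.
have a2 : 0 < 2 * a by rewrite mulr_gt0.
have W e : 0 < e -> e < s -> - (2 * a)^-1 <= (s - e) * kappa s p.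
  move=> e0 es; apply: (@weighted_gauss_bound e s cM); last by rewrite in_itv /= lexx ltW.
  move=> r; rewrite /= in_itv /= => /andP[er rs]; apply: sub.
  by rewrite /= in_itv /= (lt_le_trans e0).
have H : - (2 * a)^-1 <= s * kappa s p.
  apply/ler_addgt0Pl => d d0.
  have k0 : 0 < `|kappa s p| + 1 by rewrite ltr_wpDl.
  (* the second bound makes the error e |K| at most d *)
  pose e := Num.min (s / 2) (d / (`|kappa s p| + 1)).
  have e0 : 0 < e by rewrite lt_min !divr_gt0.
  have es : e < s.
    by rewrite gt_min ltr_pdivrMr // ltr_pMr // ltr1n.
  apply: le_trans (W e e0 es) _; rewrite mulrBl addrC lerD2r.
  have : e * `|kappa s p| <= d.
    have : e <= d / (`|kappa s p| + 1) by rewrite ge_min lexx orbT.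
    rewrite ler_pdivlMr // mulrDr mulr1; apply: le_trans.
    by rewrite lerDl ltW.
  by apply: le_trans; rewrite -mulrN ler_pM2l // -normrN ler_norm.
by rewrite invfM -mulNr ler_pdivrMr // [X in _ <= X]mulrC.
Qed.

End Surface.

(** The assumption on the derivative says that f(s) / s is nonincreasing before
    T; by continuity from the left it stays above f(T) / T, which bounds the
    difference quotients of f at T. *)
Lemma left_derivative_bound (R : realType) (f df : R -> R) (T l : R) : 0 < T ->
  (forall s, 0 < s < T -> is_derive s 1 f (df s)) ->
  (forall s, 0 < s < T -> df s <= f s / s) ->
  (s - T)^-1 * (f s - f T) @[s --> T^'-] --> l -> l <= f T / T.
Proof.
move=> T0 dfP dfle fl.
have cf : f s @[s --> T^'-] --> f T.
  have idT : (s - T : R) @[s --> T^'-] --> T - T.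
    by apply: cvgB; [exact: cvg_at_left_filter|exact: cvg_cst].
  have H : f T + (s - T) * ((s - T)^-1 * (f s - f T)) @[s --> T^'-] --> f T.
    rewrite -[X in _ --> X]addr0 -[X in _ --> _ + X](mul0r l) -(subrr T).
    by apply: cvgD; [exact: cvg_cst|exact: cvgM].
  have E : {near T^'-, (fun s => f T + (s - T) * ((s - T)^-1 * (f s - f T))) =1 f}.
    near=> s; have sT : s - T != 0 by rewrite subr_eq0; near: s; exact: nbhs_left_neq.
    by rewrite mulVKf // addrC subrK.
  exact: cvg_trans (near_eq_cvg E) H.
have mono s : 0 < s < T -> f T / T <= f s / s.
  move=> /andP[s0 sT].
  have dchi r : r \in `]s, T[ -> is_derive r 1 (fun r => f r * r^-1) ((df r - f r / r) / r).
    rewrite in_itv /= => /andP[sr rT]; have r0 : 0 < r by exact: lt_trans sr.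
    have r0T : 0 < r < T by rewrite r0.
    have rn : r != 0 by rewrite gt_eqF.
    have dinv := @is_deriveV _ id r 1 1 rn (is_derive_id r 1).
    have := is_deriveM (dfP r r0T) dinv.
    set z := (z in is_derive _ _ _ z -> _); set z' := (z in _ -> is_derive _ _ _ z).
    by suff -> : z = z' by []; rewrite /z /z' /GRing.scale /=; field.
  have chi1 r : r \in `]s, T[ -> (fun r => f r * r^-1)^`()%classic r <= 0.
    move=> rst; rewrite derive1E; have [_ ->] := dchi r rst.
    move: rst; rewrite in_itv /= => /andP[sr rT]; have r0 : 0 < r by exact: lt_trans sr.
    by rewrite pmulr_lle0 ?invr_gt0 // subr_le0 dfle // r0.
  have chic : {within `[s, T], continuous (fun r => f r * r^-1)}.
    apply/(continuous_within_itvP _ sT); split.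
    - by move=> r rst; exact: is_derive_continuous (dchi r rst).
    - have s0T : 0 < s < T by rewrite s0.
      have cs := is_derive_continuous (dfP s s0T).
      apply: cvg_at_right_filter; apply: cvgM; first exact: cs.
      by apply: cvgV; [rewrite gt_eqF|exact: cvg_id].
    - apply: cvgM; first exact: cf.
      by apply: cvg_at_left_filter; apply: cvgV; [rewrite gt_eqF|exact: cvg_id].
  exact: (ler0_derive1_nincr (fun r rst => @ex_derive _ _ _ _ _ _ _ (dchi r rst))
    chi1 chic (lexx s) (ltW sT) (lexx T)).
apply: (cvgr_to_le fl); near=> s.
have sT : s < T by near: s; exact: nbhs_left_lt.
have s0 : 0 < s by near: s; exact: nbhs_left_gt.
have sT0 : s - T < 0 by rewrite subr_lt0.
have := mono s; rewrite s0 sT => /(_ isT); rewrite ler_pdivlMr // => m.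
rewrite mulrC ler_ndivrMr // -[X in _ <= X]opprK lerNr.
have -> : f T / T * (s - T) = f T / T * s - f T by field; rewrite gt_eqF.
by rewrite lerN2 lerD2r.
Unshelve. all: by end_near. Qed.

Lemma bound_scale (R : realFieldType) (c s k : R) : 0 < c ->
  (- (c * s)^-1 <= k) = (- c * k <= s^-1).
Proof.
move=> c0; rewrite -(ler_pM2l c0) invfM mulrN mulrA divff ?gt_eqF // mul1r.
by rewrite lerNl mulNr.
Qed.

Section Bound.
Context {R : realType} (M : smooth_manifold R 2).
Variables (alpha beta T : R) (g : R -> tensor2 M).
Hypothesis cM : closed_manifold M.
Hypothesis apos : 0 < alpha + beta.
Hypothesis flow : ricci_yamabe_flow alpha beta `]0, T] g.
Local Notation a := (alpha + beta).

Let sub : `]0, T[ `<=` `]0, T].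
Proof. exact: subset_itv_oo_oc. Qed.

Let oJ : open [set` `]0, T[]. Proof. exact: interval_open. Qed.

Let flowJ : ricci_yamabe_flow alpha beta `]0, T[ g.
Proof. exact: flow_restrict sub flow. Qed.

Lemma gauss_bound_open s c p : 0 < s < T -> chart_dom (atlas c) p ->
  - (2 * a * s)^-1 <= gauss_curv (g s c) (chart_map (atlas c) p).
Proof.
move=> /andP[s0 sT] cp.
have Js : [set` `]0, T[] s by rewrite /= in_itv /= s0.
rewrite -(kappa_chart oJ flowJ apos Js cp); apply: (gauss_bound_interior oJ flowJ apos) => //.
move=> r; rewrite /= !in_itv /= => /andP[-> rs]; exact: le_lt_trans rs sT.
Qed.

(** At the final time the flow equation is one-sided.  The component f = g_00
    has left derivative -2 a K f at T, and before T the known bound reads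
    f' <= f / s. *)
Lemma gauss_bound_end c p : 0 < T -> chart_dom (atlas c) p ->
  - (2 * a * T)^-1 <= gauss_curv (g T c) (chart_map (atlas c) p).
Proof.
move=> T0 cp; set x := chart_map (atlas c) p.
have Cx : chart_cod (atlas c) x by exact: chart_map_cod.
have IT : [set` `]0, T]] T by rewrite /= in_itv /= T0 lexx.
set k := gauss_curv (g T c) x; set l := - (2 * a) * k * g T c x 0 0.
pose f s := g s c x 0 0.
have fT : 0 < f T by apply: posdef_diag; have [_ _ + _] := flow.1.1 T IT; exact.
have dT : (s - T)^-1 * (f s - f T) @[s --> T^'-] --> l.
  have H : (s - T)^-1 *: (g s c x - g T c x) @[s --> T^'-] -->
     - (2 * alpha) *: ricci (g T c) x - (beta * scalar_curv (g T c) x) *: g T c x.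
    apply: cvg_trans (flow.2 T c x IT Cx); apply: cvg_app => A /= wA.
    have H1 : T^' [set s | [set` `]0, T]] s -> A s] by exact: wA.
    have H2 : T^'- [set s | [set` `]0, T]] s -> A s].
      by apply: (@filterS _ (nbhs T)) H1 => s h sT; apply: h; rewrite lt_eqF.
    have H3 : T^'- A.
      near=> s; have Is : [set` `]0, T]] s.
        rewrite /= in_itv /=; apply/andP; split; near: s; [exact: nbhs_left_gt|exact: nbhs_left_le].
      by move: Is; near: s; exact: H2.
    exact: H3.
  have e : (- (2 * alpha) *: ricci (g T c) x - (beta * scalar_curv (g T c) x) *: g T c x) 0 0 = l.
    have lin (b d : R) (A B : 'M[R]_2) : (b *: A - d *: B) 0 0 = b * A 0 0 - d * B 0 0.
      by rewrite !mxE.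
    rewrite lin (flow_einstein flow 0 0 IT Cx) (flow_scalar flow IT Cx) /l /k; ring.
  rewrite -e.
  have E : (fun s => (s - T)^-1 * (f s - f T)) = (fun N : 'M[R]_2 => N 0 0) \o
     (fun s => (s - T)^-1 *: (g s c x - g T c x)).
    by apply/funext => s; rewrite /= !mxE.
  by rewrite E; apply: (cvg_comp _ _ H); exact: coord_continuous.
have lT : l <= f T / T.
  apply: (left_derivative_bound T0 _ _ dT) => s s0T.
    have Js : [set` `]0, T[] s by rewrite /= in_itv.
    exact: (flow_entry oJ flowJ 0 0 Js Cx).
  have Js : [set` `]0, T[] s by rewrite /= in_itv.
  have fs : 0 < f s by exact: posdef_diag (flow_posdef flowJ Js Cx).
  have s0 : 0 < s by case/andP: s0T.
  by rewrite [X in _ <= X]mulrC ler_pM2r // -bound_scale ?mulr_gt0 // gauss_bound_open.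
have a2 : 0 < 2 * a by rewrite mulr_gt0.
rewrite (bound_scale _ _ a2); move: lT; rewrite /l [X in _ <= X]mulrC.
by rewrite ler_pM2r.
Unshelve. all: by end_near. Qed.

Theorem gauss_lower_bound t c p : t \in `]0, T] -> chart_dom (atlas c) p ->
  - (2 * a * t)^-1 <= gauss_curv (g t c) (chart_map (atlas c) p).
Proof.
rewrite in_itv /= => /andP[t0]; rewrite le_eqVlt => /orP[/eqP tT|tT] cp.
  by move: t0; rewrite tT => T0; exact: gauss_bound_end.
by apply: gauss_bound_open; rewrite ?t0.
Qed.
End Bound.

(** * The evolution equations and the lower bound *)

Lemma constant_on_interval (R : realType) (I : set R) (f : R -> R) :
  is_interval I -> (forall t, I t -> is_derive t 1 f 0) ->
  forall s t, I s -> I t -> f s = f t.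
Proof.
move=> iI df; suff H s t : s <= t -> I s -> I t -> f s = f t.
  by move=> s t Is It; have [st|/ltW ts] := leP s t; [exact: H|symmetry; exact: H].
move=> st Is It; have sub r : r \in `[s, t] -> I r by rewrite in_itv /=; exact: (iI s t).
have [||r _] := @MVT_segment R f (fun=> 0) s t st.
- by move=> r /subset_itv_oo_cc/sub/df.
- by apply: derivable_within_continuous => r /sub/df[].
by rewrite mul0r => /eqP; rewrite subr_eq0 => /eqP.
Qed.

Theorem proposition1 (R : realType) (alpha beta : R) :
  (forall (n : nat) (M : smooth_manifold R n) (I : set R) (g : R -> tensor2 M),
     open I -> is_interval I -> ricci_yamabe_flow alpha beta I g ->
     [/\ (* (1) *)
         forall t c x (i j k : 'I_n), I t -> chart_cod (atlas c) x ->
           let G := g t c in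
           is_derive t 1 (fun s : R => christoffel (g s c) k i j x)
             (alpha * (\sum_l ginv G x k l *
                (cov_deriv2 G (ricci G) l i j x
                 - cov_deriv2 G (ricci G) i j l x
                 - cov_deriv2 G (ricci G) j i l x))
              - beta / 2 *
                (pderiv i (scalar_curv G) x * (k == j)%:R
                 + pderiv j (scalar_curv G) x * (k == i)%:R
                 - grad G (scalar_curv G) k x * G x i j)),
         (* (2) *)
         forall t c x, I t -> chart_cod (atlas c) x ->
           let G := g t c in
           is_derive t 1 (fun s : R => scalar_curv (g s c) x)
             ((alpha + (n%:R - 1) * beta) * laplacian G (scalar_curv G) x
              + 2 * alpha * norm2_tensor2 G (ricci G) x
              + beta * scalar_curv G x ^+ 2),
         (* (3) *)
         forall t c x (X : 'M[R]_n), I t -> chart_cod (atlas c) x ->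
           let G := g t c in
           is_derive t 1 (fun s : R => volume_form (g s c) x X)
             (- (alpha + n%:R / 2 * beta) * scalar_curv G x
              * volume_form G x X)
       & 2 * alpha + n%:R * beta = 0 ->
         (forall s t c x (X : 'M[R]_n), I s -> I t -> chart_cod (atlas c) x ->
            volume_form (g s c) x X = volume_form (g t c) x X) /\
         (alpha != 0 ->
          forall t c x, I t -> chart_cod (atlas c) x ->
            let G := g t c in
            let dR := derive1 (fun s : R => scalar_curv (g s c) x) t in
            alpha^-1 * dR =
              (2 - n%:R) / n%:R * laplacian G (scalar_curv G) x
              + 2 * norm2_tensor2 G (ricci G) x
              - 2 / n%:R * scalar_curv G x ^+ 2 /\
            (n = 2%N -> alpha^-1 * dR = 0)) ]) /\
  (* n = 2 in (2) *)
  (forall (M : smooth_manifold R 2) (I : set R) (g : R -> tensor2 M),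
     open I -> is_interval I -> ricci_yamabe_flow alpha beta I g ->
     forall t c x, I t -> chart_cod (atlas c) x ->
       let G := g t c in
       is_derive t 1 (fun s : R => scalar_curv (g s c) x)
         ((alpha + beta) *
            (laplacian G (scalar_curv G) x + scalar_curv G x ^+ 2)) /\
       is_derive t 1 (fun s : R => gauss_curv (g s c) x)
         ((alpha + beta) *
            (laplacian G (gauss_curv G) x + 2 * gauss_curv G x ^+ 2))) /\
  (forall (M : smooth_manifold R 2) (T : R) (g : R -> tensor2 M),
     closed_manifold M -> 1 <= alpha + beta ->
     ricci_yamabe_flow alpha beta `]0, T] g ->
     forall t c (p : M), t \in `]0, T] -> chart_dom (atlas c) p ->
       - (2 * (alpha + beta) * t)^-1
         <= gauss_curv (g t c) (chart_map (atlas c) p)).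
Proof.
split; [|split].
- move=> n M I g oI iI flow.
  have sm := flow_smooth oI flow; have sym := flow_sym flow.
  have un := flow_unit flow; have dg := flow_derive oI flow.
  have dscal t c x : I t -> chart_cod (atlas c) x ->
      is_derive t 1 (fun s => scalar_curv (g s c) x)
        ((alpha + (n%:R - 1) * beta) * laplacian (g t c) (scalar_curv (g t c)) x
         + 2 * alpha * norm2_tensor2 (g t c) (ricci (g t c)) x
         + beta * scalar_curv (g t c) x ^+ 2).
    by move=> It Cx; exact: (local_flow_scal oI (chart_open (c := c)) (sm c) (sym c) (un c) (dg c) It Cx).
  split.
  + move=> t c x i j k It Cx.
    exact: (local_flow_christoffel oI (chart_open (c := c)) (sm c) (sym c) (un c) (dg c) k i j It Cx).
  + exact: dscal.
  + by move=> t c x X It Cx; exact: (flow_volume oI flow X It Cx).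
  move=> ab; split.
    move=> s t c x X Is It Cx.
    apply: (constant_on_interval (f := fun r => volume_form (g r c) x X) iI) => // r Ir.
    have := flow_volume oI flow X Ir Cx.
    have -> : alpha + n%:R / 2 * beta = (2 * alpha + n%:R * beta) / 2 by field.
    by rewrite ab mul0r oppr0 !mul0r.
  move=> a0 t c x It Cx G dR.
  have n0 : n%:R != 0 :> R.
    apply/eqP => n0; move: ab; rewrite n0 mul0r addr0 => /eqP.
    by rewrite mulf_eq0 pnatr_eq0 /= (negPf a0).
  have bE : beta = - (2 * alpha) / n%:R.
    by apply: (mulfI n0); rewrite mulrCA divff // mulr1; move/eqP: ab; rewrite addrC addr_eq0 => /eqP.
  have dRE : alpha^-1 * dR =
      (2 - n%:R) / n%:R * laplacian G (scalar_curv G) x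
      + 2 * norm2_tensor2 G (ricci G) x - 2 / n%:R * scalar_curv G x ^+ 2.
    rewrite /dR derive1E; have [_ ->] := dscal t c x It Cx; rewrite -/G bE; field.
    by rewrite n0 a0.
  split => // n2; rewrite dRE {dRE bE}.
  subst n; rewrite subrr !mul0r add0r.
  by rewrite /G (flow_norm flow It Cx) (flow_scalar flow It Cx) divff ?pnatr_eq0 //; ring.
- move=> M I g oI iI flow t c x It Cx; split.
    exact: (flow_scalar_derive oI flow It Cx).
  exact: (flow_gauss_derive oI flow It Cx).
- move=> M T g cM ab flow t c p tT cp.
  apply: (gauss_lower_bound cM _ flow tT cp).
  exact: lt_le_trans ab.
Qed.
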